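(* Let $X_0\subset\mathbb{P}^6$ be the singular del Pezzo surface of degree $6$ described in the context. Then the saturation number satisfies $r(X_0(\mathbb{Z}),x_0\cdots x_6)\leq 45$; that is, the set of primitive vectors $\mathbf{x}=(x_0,\ldots,x_6)\in\mathbb{Z}^7$ with $[\mathbf{x}]\in X_0$ and such that $x_0\cdots x_6$ is a product of at most $45$ primes is Zariski dense in $X_0$.
   Context: $X_0\subset\mathbb{P}^6$ denotes a (split) singular del Pezzo surface of degree $6$ defined over $\mathbb{Q}$, anticanonically embedded as an intersection of $9$ quadrics, with a single singularity of type $\mathbf{A}_2$ and with both of its two lines defined over $\mathbb{Q}$. Concretely, $X_0$ is the image of the affine hypersurface $\eta_2\alpha_1^2+\eta_3\alpha_2+\eta_4\alpha_3=0$ in $\mathbb{A}^7$ (coordinates $\eta_1,\ldots,\eta_4,\alpha_1,\alpha_2,\alpha_3$) under the morphism $(\boldsymbol\eta,\boldsymbol\alpha)\mapsto(\alpha_2\alpha_3,\ \eta^{(1,1,1,0)}\alpha_1\alpha_2,\ \eta^{(1,1,0,1)}\alpha_1\alpha_3,\ \eta^{(2,1,2,1)}\alpha_2,\ \eta^{(2,1,1,2)}\alpha_3,\ \eta^{(4,2,3,3)},\ \eta^{(3,2,2,2)}\alpha_1)$, where $\eta^{(a,b,c,d)}=\eta_1^a\eta_2^b\eta_3^c\eta_4^d$ (more precisely, the Zariski closure of the image of the open subset where this is defined). Rational points of $X_0$ are identified with primitive integer vectors $\mathbf{x}\in\mathbb{Z}^7$ (up to sign), giving $X_0(\mathbb{Z})$.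 The saturation number $r(X_0(\mathbb{Z}),x_0\cdots x_6)$ is the least $r$ such that the set of $\mathbf{x}\in\mathbb{Z}^7$ with $[\mathbf{x}]\in X_0(\mathbb{Z})$ and $x_0\cdots x_6$ a product of at most $r$ primes (counted with multiplicity, up to sign) is Zariski dense in $X_0$. *)

(* Defs.v *)
From mathcomp Require Import all_boot all_order all_algebra all_field.
From mathcomp Require Export mpoly.

Set Implicit Arguments.
Unset Strict Implicit.
Unset Printing Implicit Defensive.

Import GRing.Theory Num.Theory.
Local Open Scope ring_scope.

(* A point of P^(n-1) is represented by any nonzero vector of homogeneous
   coordinates. Varieties are over Q: closed sets are cut out by homogeneous
   forms with rational coefficients, and are identified with their geometric
   points (over algC, an algebraic closure of Q). *)

Definition vanishes_at n (f : {mpoly rat[n]}) (x : 'rV[algC]_n) : Prop :=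
  (map_mpoly (ratr : rat -> algC) f).@[x 0] = 0.

Definition zariski_closure n (A : 'rV[algC]_n -> Prop) (x : 'rV[algC]_n) : Prop :=
  x != 0 /\
  forall (d : nat) (f : {mpoly rat[n]}), f \is d.-homog ->
    (forall a, A a -> vanishes_at f a) -> vanishes_at f x.

Definition zariski_dense n (A X : 'rV[algC]_n -> Prop) : Prop :=
  (forall x, A x -> X x) /\ (forall x, X x -> zariski_closure A x).

Definition etapow (e1 e2 e3 e4 : algC) (a b c d : nat) : algC :=
  e1 ^+ a * e2 ^+ b * e3 ^+ c * e4 ^+ d.

Definition torsor_map (e1 e2 e3 e4 a1 a2 a3 : algC) : 'rV[algC]_7 :=
  \row_(i < 7) [:: a2 * a3;
                   etapow e1 e2 e3 e4 1 1 1 0 * a1 * a2;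
                   etapow e1 e2 e3 e4 1 1 0 1 * a1 * a3;
                   etapow e1 e2 e3 e4 2 1 2 1 * a2;
                   etapow e1 e2 e3 e4 2 1 1 2 * a3;
                   etapow e1 e2 e3 e4 4 2 3 3;
                   etapow e1 e2 e3 e4 3 2 2 2 * a1]`_i.

Definition torsor_image (x : 'rV[algC]_7) : Prop :=
  exists e1 e2 e3 e4 a1 a2 a3 : algC,
    [/\ e2 * a1 ^+ 2 + e3 * a2 + e4 * a3 = 0,
        x = torsor_map e1 e2 e3 e4 a1 a2 a3 & x != 0].

Definition X0 : 'rV[algC]_7 -> Prop := zariski_closure torsor_image.

Definition primitive n (x : 'rV[int]_n) : Prop :=
  \big[gcdn/0%N]_(i < n) `|x 0%R i|%N = 1%N.

(* m is, up to sign, a product of at most r primes, counted with multiplicity;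
   this excludes m = 0 and allows the empty product. *)
Definition almost_prime (r : nat) (m : int) : Prop :=
  exists s : seq nat,
    [/\ all prime s, (size s <= r)%N & `|m|%N = (\prod_(p <- s) p)%N].

Definition almost_prime_points n (X : 'rV[algC]_n -> Prop)
    (F : 'rV[int]_n -> int) (r : nat) (y : 'rV[algC]_n) : Prop :=
  exists x : 'rV[int]_n,
    [/\ y = map_mx intr x, primitive x, X y & almost_prime r (F x)].

Definition is_saturation_number n (X : 'rV[algC]_n -> Prop)
    (F : 'rV[int]_n -> int) (r : nat) : Prop :=
  zariski_dense (almost_prime_points X F r) X /\
  forall s : nat, zariski_dense (almost_prime_points X F s) X -> (r <= s)%N.

Definition coord_prod n (x : 'rV[int]_n) : int := \prod_(i < n) x 0 i.

(* Main.v *)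
(* Points with eta = (p, 1, 1, 1), alpha = (1, b, - 1 - b), p a prime not
   dividing b (b + 1), are primitive, and their coordinate product is
   p^13 (b (b + 1))^3 up to sign: 13 + 3 Omega(b (b + 1)) prime factors. The
   torus acting on the torsor moves a general point of X_0 to this form with p
   and b arbitrary, so infinitely many b with Omega(b (b + 1)) <= 10 suffice.

   Such b are found as b = 2 n with Omega(n (2 n + 1)) <= 9, where
   n = W (t + 1) - 1 and W = w! for a large w, by averaging over t < N = D^(13/4)
   against the square of Selberg's weight
     L(t) = sum_R h(R) y_R prod_(p in R) xi_p(t),  y_R = max(0, log(D / |R|)),
   R running over sets of primes in ]w, D]. The functions prod_(p in R) xi_p are
   orthogonal over full periods, so with J = sum h(R) y_R^2, G = sum h(R) y_R the
   mean of L^2 is about J, and that of L^2 over the t with p | n (2 n + 1) is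
     (2 / p) sum h(R) (y_R - y_(R + p))^2 <= (2 / p) log p G,
   as 0 <= y_R - y_(R + p) <= min(y_R, log p). Moreover log D * G <= 2.21 J. Hence
   the weighted mean of sum_(p | n (2 n + 1)) (1 - log p / log D), with an extra
   penalty on primes p <= D^(1/40), is below 69/20, while log (n (2 n + 1)) is at
   most 262/40 log D. The t for which the square of a prime larger than D^(1/40)
   divides n or 2 n + 1 are too few to matter. *)

From Stdlib Require Import Rdefinitions Rpower Classical_Prop.
Require Import Defs.
From mathcomp Require Import all_boot all_order all_algebra all_field.
From mathcomp Require Import Rstruct.
From mathcomp Require Import zify ring lra.

Set Implicit Arguments.
Unset Strict Implicit.
Unset Printing Implicit Defensive.

Import Order.TTheory GRing.Theory Num.Theory.
Bind Scope ring_scope with R.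
Local Open Scope ring_scope.

(** * Sums of periodic functions *)

Section PeriodicSums.
Variable K : realFieldType.
Implicit Types (f g phi : nat -> K) (q N : nat).

Definition periodic q f := forall t, f (t + q)%N = f t.

Lemma periodic_mulr q f k t : periodic q f -> f (t + k * q)%N = f t.
Proof.
move=> fq; elim: k => [|k IHk]; first by rewrite mul0n addn0.
by rewrite mulSn addnCA addnC fq.
Qed.

Lemma periodic_mod q f t : periodic q f -> f (t %% q)%N = f t.
Proof. by move=> fq; rewrite {2}(divn_eq t q) addnC periodic_mulr. Qed.

Lemma periodic_mull q f k : periodic q f -> periodic (k * q) f.
Proof. by move=> fq t; exact: periodic_mulr. Qed.

Lemma periodicM q f g :
  periodic q f -> periodic q g -> periodic q (fun t => f t * g t).
Proof. by move=> fq gq t; rewrite fq gq. Qed.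

Lemma sum_blocks f q k :
  \sum_(t < k * q) f t = \sum_(i < k) \sum_(j < q) f (i * q + j)%N.
Proof.
elim: k => [|k IHk]; first by rewrite !big_ord0.
rewrite big_ord_recr /= -IHk mulSn addnC big_split_ord /=.
by congr (_ + _).
Qed.

Lemma sum_periodic_shift a b g i : coprime a b -> (0 < b)%N -> periodic b g ->
  \sum_(j < b) g (j * a + i)%N = \sum_(j < b) g j.
Proof.
case: b => // b cab _ gb.
pose h (j : 'I_b.+1) : 'I_b.+1 := inord ((j * a + i) %% b.+1).
have hE j : h j = ((j * a + i) %% b.+1)%N :> nat by rewrite inordK ?ltn_mod.
have inj_h : injective h.
  move=> j k /(congr1 (@nat_of_ord _)); rewrite !hE => /eqP.
  rewrite eqn_modDr => ejk; apply/val_inj => /=.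
  have: (j == k %[mod b.+1])%N.
    wlog le_jk : j k ejk / (j <= k)%N.
      move=> Hw; case: (leqP j k) => [|/ltnW] h1; first exact: Hw.
      by rewrite eq_sym; apply: Hw => //; rewrite eq_sym.
    rewrite eq_sym eqn_mod_dvd // -(@Gauss_dvdl _ _ a) 1?coprime_sym // mulnBl.
    by rewrite -eqn_mod_dvd ?leq_mul2r ?le_jk ?orbT // eq_sym.
  by rewrite !modn_small // => /eqP.
rewrite [RHS](reindex_inj inj_h); apply: eq_bigr => j _.
by rewrite hE periodic_mod.
Qed.

Lemma sum_periodic_coprime a b f g : coprime a b -> (0 < b)%N ->
    periodic a f -> periodic b g ->
  \sum_(t < a * b) f t * g t = (\sum_(t < a) f t) * \sum_(t < b) g t.
Proof.
move=> cab b0 fa gb; rewrite mulnC (sum_blocks (fun t => f t * g t)).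
rewrite exchange_big mulr_suml.
apply: eq_bigr => i _ /=; rewrite -(@sum_periodic_shift a b g i) // mulr_sumr.
by apply: eq_bigr => j _; rewrite addnC periodic_mulr // addnC.
Qed.

Lemma sum_periodic_prod (I : eqType) (q : I -> nat) (F : I -> nat -> K)
    (s : seq I) m phi : uniq s -> periodic m phi ->
    {in s, forall i, [/\ (0 < q i)%N, coprime m (q i) & periodic (q i) (F i)]} ->
    {in s &, forall i j, i != j -> coprime (q i) (q j)} ->
  \sum_(t < m * \prod_(i <- s) q i) phi t * \prod_(i <- s) F i t =
    (\sum_(t < m) phi t) * \prod_(i <- s) \sum_(t < q i) F i t.
Proof.
elim: s m phi => [|a s IHs] m phi /=.
  by move=> _ _ _ _; rewrite !big_nil muln1 mulr1; under eq_bigr do rewrite big_nil mulr1.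
case/andP=> a_s us phim sP sC; rewrite !big_cons mulnA.
have [qa ca Fa] := sP a (mem_head _ _).
transitivity (\sum_(t < m * q a * \prod_(i <- s) q i)
    (phi t * F a t) * \prod_(i <- s) F i t).
  by apply: eq_bigr => t _; rewrite big_cons mulrA.
rewrite (IHs _ (fun t => phi t * F a t)) //.
- by rewrite sum_periodic_coprime // mulrA.
- by apply: periodicM; [rewrite mulnC|]; exact: periodic_mull.
- move=> i i_s; have [|qi ci Fi] := sP i; first by rewrite inE i_s orbT.
  split => //; rewrite coprimeMl ci sC ?mem_head // ?inE ?i_s ?orbT //.
  by apply: contraNneq a_s => ->.
by move=> i j i_s j_s; apply: sC; rewrite inE ?i_s ?j_s orbT.
Qed.

Lemma sum_periodic_mean q f N : (0 < q)%N -> periodic q f ->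
  `|\sum_(t < N) f t - N%:R / q%:R * \sum_(t < q) f t|
    <= 2 * \sum_(t < q) `|f t|.
Proof.
move=> q0 fq; have qR0 : (0 : K) < q%:R by rewrite ltr0n.
have le_r : (N %% q <= q)%N by rewrite ltnW ?ltn_mod.
have -> : \sum_(t < N) f t =
    (N %/ q)%:R * \sum_(t < q) f t + \sum_(t < N %% q) f t.
  have -> : \sum_(t < N) f t = \sum_(t < N %/ q * q + N %% q) f t.
    by rewrite -divn_eq.
  rewrite big_split_ord /= sum_blocks; congr (_ + _).
    rewrite mulr_natl -[in RHS](card_ord (N %/ q)) -sumr_const.
    by apply: eq_bigr => i _; apply: eq_bigr => j _; rewrite addnC periodic_mulr.
  by apply: eq_bigr => j _; rewrite addnC periodic_mulr.
have -> : N%:R / q%:R = (N %/ q)%:R + (N %% q)%:R / q%:R :> K.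
  by rewrite {1}(divn_eq N q) natrD natrM mulrDl mulfK ?gt_eqF.
set A := \sum_(t < q) f t; set r := _ / _.
have -> : (N %/ q)%:R * A + \sum_(t < N %% q) f t - ((N %/ q)%:R + r) * A =
  \sum_(t < N %% q) f t - r * A by ring.
have h1 : `|\sum_(t < N %% q) f t| <= \sum_(t < q) `|f t|.
  apply: le_trans (ler_norm_sum _ _ _) _.
  rewrite (big_ord_widen _ (fun t => `|f t|) le_r) big_mkcond /=.
  by apply: ler_sum => t _; case: ifP.
have h2 : `|r * A| <= \sum_(t < q) `|f t|.
  have r01 : 0 <= r <= 1.
    by rewrite divr_ge0 ?ler0n //= ler_pdivrMr // mul1r ler_nat.
  rewrite normrM (ger0_norm (andP r01).1).
  apply: le_trans (ler_norm_sum _ _ _).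
  by rewrite ler_piMl ?normr_ge0 // (andP r01).2.
by apply: le_trans (ler_normB _ _) _; rewrite mulr2n mulrDl mul1r lerD.
Qed.

End PeriodicSums.

Section QuadraticForm.
Variables (K : realFieldType) (I : finType).
Variables (q : I -> nat) (h : I -> K) (xi : I -> nat -> K) (P : {set I}).
Variables (m : nat) (phi : nat -> K) (Z : {set I} -> K).

Hypothesis q_gt0 : {in P, forall i, (0 < q i)%N}.
Hypothesis h_gt0 : {in P, forall i, 0 < h i}.
Hypothesis q_coprime : {in P &, forall i j, i != j -> coprime (q i) (q j)}.
Hypothesis xi_periodic : {in P, forall i, periodic (q i) (xi i)}.
Hypothesis sum_xi : {in P, forall i, \sum_(t < q i) xi i t = 0}.
Hypothesis sum_xi2 : {in P, forall i, \sum_(t < q i) xi i t ^+ 2 = (q i)%:R / h i}.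
Hypothesis sum_norm_xi : {in P, forall i, \sum_(t < q i) `|xi i t| <= (2 * q i)%:R}.
Hypothesis q_le_h : {in P, forall i, (q i)%:R / h i <= (2 * q i)%:R ^+ 2}.
Hypothesis m_gt0 : (0 < m)%N.
Hypothesis m_coprime : {in P, forall i, coprime m (q i)}.
Hypothesis phi_periodic : periodic m phi.

Let e (A : {set I}) t := \prod_(i in A) xi i t.

Lemma quad_form_pair (A B : {set I}) N : A \subset P -> B \subset P ->
  `|\sum_(t < N) phi t * (e A t * e B t) -
     N%:R / m%:R * (\sum_(t < m) phi t) *
       (if A == B then (\prod_(i in A) h i)^-1 else 0)|
  <= 2 * (\sum_(t < m) `|phi t|) *
     ((\prod_(i in A) (2 * q i)%:R) * \prod_(i in B) (2 * q i)%:R).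
Proof.
move=> sAP sBP; pose U := A :|: B.
have sUP : U \subset P by rewrite subUset sAP.
pose F i t := (if i \in A then xi i t else 1) * (if i \in B then xi i t else 1).
have eE t : e A t * e B t = \prod_(i <- enum U) F i t.
  rewrite big_enum /= /e /F big_split /= -!big_mkcondr /=.
  congr (_ * _); apply: eq_bigl => i; rewrite in_setU; first by case: (i \in A); rewrite ?andbT ?andbF.
  by case: (i \in B); rewrite ?orbT ?andbT ?andbF.
pose Q := (m * \prod_(i <- enum U) q i)%N.
have inU i : i \in enum U -> i \in P by rewrite mem_enum => /(subsetP sUP).
have FP (G : K -> K) : {in enum U, forall i,
   [/\ (0 < q i)%N, coprime m (q i) & periodic (q i) (fun t => G (F i t))]}.
  move=> i /inU iP; split; [exact: q_gt0|exact: m_coprime|].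
  by move=> t; rewrite /F xi_periodic.
have cop : {in enum U &, forall i j, i != j -> coprime (q i) (q j)}.
  by move=> i j /inU iP /inU jP; exact: q_coprime.
have Q0 : (0 < Q)%N.
  by rewrite muln_gt0 m_gt0 big_seq prodn_cond_gt0 // => i /inU /q_gt0.
have eper : periodic Q (fun t => phi t * (e A t * e B t)).
  apply: periodicM; first by rewrite /Q mulnC; exact: periodic_mull.
  move=> t; rewrite !eE; apply: eq_big_seq => i iU.
  have [_ _ Fi] := FP id i iU.
  rewrite -[RHS](periodic_mull (Q %/ q i) Fi) divnK //.
  by rewrite /Q dvdn_mull // (big_rem i iU) /= dvdn_mulr.
have := sum_periodic_mean N Q0 eper.
have -> : \sum_(t < Q) phi t * (e A t * e B t) =
    (\sum_(t < m) phi t) * \prod_(i <- enum U) \sum_(t < q i) F i t.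
  rewrite -(sum_periodic_prod (enum_uniq U) phi_periodic (FP id) cop).
  by apply: eq_bigr => t _; rewrite eE.
have -> : \sum_(t < Q) `|phi t * (e A t * e B t)| =
    (\sum_(t < m) `|phi t|) * \prod_(i <- enum U) \sum_(t < q i) `|F i t|.
  have norm_phi : periodic m (fun t => `|phi t|).
    by move=> t; rewrite phi_periodic.
  rewrite -(sum_periodic_prod (enum_uniq U) norm_phi (FP Num.norm) cop).
  by apply: eq_bigr => t _; rewrite eE normrM normr_prod.
have -> : N%:R / Q%:R * ((\sum_(t < m) phi t) *
      \prod_(i <- enum U) \sum_(t < q i) F i t) =
   N%:R / m%:R * (\sum_(t < m) phi t) *
       (if A == B then (\prod_(i in A) h i)^-1 else 0).
  rewrite /Q natrM invfM natr_prod.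
  suff -> : \prod_(i <- enum U) \sum_(t < q i) F i t =
      (\prod_(i <- enum U) (q i)%:R) *
      (if A == B then (\prod_(i in A) h i)^-1 else 0).
    have : \prod_(i <- enum U) (q i)%:R != 0 :> K.
      rewrite -natr_prod pnatr_eq0 -lt0n big_seq prodn_cond_gt0 //.
      by move=> i /inU /q_gt0.
    move: (\prod_(i <- enum U) (q i)%:R) => x x0.
    have : m%:R != 0 :> K by rewrite pnatr_eq0 -lt0n.
    by move=> ?; field; apply/andP.
  rewrite !big_enum /=; case: eqP => [eAB|/eqP nAB].
    rewrite -prodfV /U -eAB setUid -big_split /=; apply: eq_bigr => i iA.
    rewrite -sum_xi2 ?(subsetP sAP) //; apply: eq_bigr => t _.
    by rewrite /F -eAB iA expr2.
  rewrite mulr0.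
  have [i iAB] : exists i, (i \in A) (+) (i \in B).
    apply/existsP; apply: contra_neqT nAB; rewrite negb_exists => /forallP H.
    by apply/setP => i; move: (H i); case: (i \in A); case: (i \in B).
  have iU : i \in U by rewrite in_setU; move: iAB; case: (i \in A).
  rewrite (bigD1 i) //=; have -> : \sum_(t < q i) F i t = 0; last by rewrite mul0r.
  rewrite -[RHS](sum_xi (subsetP sUP _ iU)); apply: eq_bigr => t _; rewrite /F.
  by move: iAB; case: (i \in A); case: (i \in B) => //= _; rewrite ?mulr1 ?mul1r.
move=> /le_trans; apply; rewrite mulrA ler_wpM2l ?mulr_ge0 ?sumr_ge0 //.
rewrite big_enum /=.
apply: (@le_trans _ _ (\prod_(i in U) ((if i \in A then (2 * q i)%:R else 1) *
    (if i \in B then (2 * q i)%:R else 1)))).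
  apply: ler_prod => i iU; rewrite sumr_ge0 //=.
  have iP := subsetP sUP _ iU; move: iU; rewrite in_setU /F.
  case: (i \in A); case: (i \in B) => //= _; rewrite ?mulr1 ?mul1r.
  - rewrite -expr2; apply: le_trans (q_le_h iP); rewrite -sum_xi2 //.
    by apply: ler_sum => t _; rewrite -expr2 ger0_norm // sqr_ge0.
  - by under eq_bigr do rewrite mulr1; exact: sum_norm_xi.
  - by under eq_bigr do rewrite mul1r; exact: sum_norm_xi.
rewrite big_split /= -!big_mkcondr /=; rewrite le_eqVlt; apply/orP; left; apply/eqP.
congr (_ * _);
  apply: eq_bigl => i; rewrite in_setU; first by case: (i \in A); rewrite ?andbT ?andbF.
by case: (i \in B); rewrite ?orbT ?andbT ?andbF.
Qed.

Lemma quad_form_estimate N :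
  `|\sum_(t < N) phi t *
       (\sum_(A : {set I} | A \subset P) (\prod_(i in A) h i) * Z A * e A t) ^+ 2 -
    N%:R / m%:R * (\sum_(t < m) phi t) *
       (\sum_(A : {set I} | A \subset P) (\prod_(i in A) h i) * Z A ^+ 2)|
  <= 2 * (\sum_(t < m) `|phi t|) *
     (\sum_(A : {set I} | A \subset P)
        (\prod_(i in A) h i) * `|Z A| * \prod_(i in A) (2 * q i)%:R) ^+ 2.
Proof.
pose c (A : {set I}) := (\prod_(i in A) h i) * Z A.
have hA0 (A : {set I}) : A \subset P -> 0 < \prod_(i in A) h i.
  by move=> sA; apply: prodr_gt0 => i iA; rewrite h_gt0 // (subsetP sA).
have -> : \sum_(t < N) phi t * (\sum_(A : {set I} | A \subset P) c A * e A t) ^+ 2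
   = \sum_(A : {set I} | A \subset P) \sum_(B : {set I} | B \subset P)
        c A * c B * \sum_(t < N) phi t * (e A t * e B t).
  transitivity (\sum_(t < N) \sum_(A : {set I} | A \subset P)
     \sum_(B : {set I} | B \subset P) c A * c B * (phi t * (e A t * e B t))).
    apply: eq_bigr => t _; rewrite expr2 mulr_suml mulr_sumr.
    apply: eq_bigr => A _; rewrite !mulr_sumr; apply: eq_bigr => B _; ring.
  rewrite exchange_big; apply: eq_bigr => A _; rewrite exchange_big.
  by apply: eq_bigr => B _; rewrite mulr_sumr.
set u := N%:R / m%:R * _.
have -> : u * (\sum_(A : {set I} | A \subset P) (\prod_(i in A) h i) * Z A ^+ 2) =
   \sum_(A : {set I} | A \subset P) \sum_(B : {set I} | B \subset P)
     c A * c B * (u * (if A == B then (\prod_(i in A) h i)^-1 else 0)).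
  rewrite mulr_sumr; apply: eq_bigr => A sA.
  rewrite (bigD1 A) //= eqxx [X in _ + X]big1 ?addr0.
    rewrite /c; move: (hA0 A sA); move: (\prod_(i in A) h i) => x x0.
    by field; rewrite gt_eqF.
  by move=> B /andP[_ nBA]; rewrite eq_sym (negPf nBA) !mulr0.
rewrite -sumrB; under eq_bigr do rewrite -sumrB.
apply: le_trans (ler_norm_sum _ _ _) _.
rewrite [leRHS](_ : _ =
   \sum_(A : {set I} | A \subset P) \sum_(B : {set I} | B \subset P)
     `|c A| * `|c B| * (2 * (\sum_(t < m) `|phi t|) *
     ((\prod_(i in A) (2 * q i)%:R) * \prod_(i in B) (2 * q i)%:R))).
  apply: ler_sum => A sA; apply: le_trans (ler_norm_sum _ _ _) _.
  apply: ler_sum => B sB; rewrite -mulrBr normrM (normrM (c A)).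
  by rewrite ler_wpM2l ?mulr_ge0 // quad_form_pair.
rewrite expr2 mulr_suml mulr_sumr; apply: eq_bigr => A sA.
rewrite !mulr_sumr; apply: eq_bigr => B sB.
rewrite /c !normrM !(gtr0_norm (hA0 _ _)) //; ring.
Qed.

End QuadraticForm.

(** * Logarithms and sums over primes *)

Definition lg (n : nat) : R := ln n%:R.

Lemma ln_le_sub1 (x : R) : 0 < x -> ln x <= x - 1.
Proof.
move=> /RltP x0; have /RleP := exp_ineq1_le (ln x).
by rewrite exp_ln // RplusE R1E; lra.
Qed.

Lemma lnM (x y : R) : 0 < x -> 0 < y -> ln (x * y) = ln x + ln y.
Proof. by move=> /RltP x0 /RltP y0; exact: ln_mult. Qed.

Lemma lg1 : lg 1 = 0.
Proof. exact: ln_1. Qed.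

Lemma lgM m n : (0 < m)%N -> (0 < n)%N -> lg (m * n) = lg m + lg n.
Proof. by move=> m0 n0; rewrite /lg natrM lnM ?ltr0n. Qed.

Lemma lgX m k : (0 < m)%N -> lg (m ^ k) = k%:R * lg m.
Proof.
move=> m0; elim: k => [|k IHk]; first by rewrite expn0 lg1 mul0r.
by rewrite expnS lgM ?expn_gt0 ?m0 // IHk -natr1 mulrDl mul1r addrC.
Qed.

Lemma lg_diff_le n : (0 < n)%N -> lg n.+1 - lg n <= n%:R^-1.
Proof.
move=> n0; have n0R : (0 : R) < n%:R by rewrite ltr0n.
have xE : n.+1%:R = n%:R * (1 + n%:R^-1) :> R.
  by rewrite mulrDr mulr1 mulfV ?gt_eqF // natr1.
have x0 : 0 < 1 + n%:R^-1 :> R by rewrite ltr_wpDr ?invr_ge0.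
rewrite /lg xE lnM //; have := ln_le_sub1 x0; lra.
Qed.

Lemma lg_diff_ge n : (0 < n)%N -> n.+1%:R^-1 <= lg n.+1 - lg n.
Proof.
move=> n0; have n0R : (0 : R) < n%:R by rewrite ltr0n.
have n1R : (0 : R) < n.+1%:R by rewrite ltr0n.
have xE : n%:R = n.+1%:R * (1 - n.+1%:R^-1) :> R.
  by rewrite mulrBr mulr1 mulfV ?gt_eqF // -natr1 addrK.
have x0 : 0 < 1 - n.+1%:R^-1 :> R.
  by rewrite -(pmulr_rgt0 _ n1R) -xE.
have lgE : lg n = lg n.+1 + ln (1 - n.+1%:R^-1) by rewrite {1}/lg xE lnM.
have := ln_le_sub1 x0; rewrite lgE; move: (ln _) (lg n.+1) => a b.
move: (n.+1%:R^-1 : R) => c; lra.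
Qed.

Lemma lg_ltS n : (0 < n)%N -> lg n < lg n.+1.
Proof.
move=> n0; rewrite -subr_gt0; apply: lt_le_trans (lg_diff_ge n0).
by rewrite invr_gt0 ltr0n.
Qed.

Lemma lg_le m n : (0 < m)%N -> (m <= n)%N -> lg m <= lg n.
Proof.
move=> m0; elim: n => [|n IHn]; first by rewrite leqn0 => /eqP ->.
rewrite leq_eqVlt => /predU1P[-> //|]; rewrite ltnS => le_mn.
exact: le_trans (IHn le_mn) (ltW (lg_ltS (leq_trans m0 le_mn))).
Qed.

Lemma lg_ge0 n : (0 < n)%N -> 0 <= lg n.
Proof. by move=> n0; rewrite -lg1 lg_le. Qed.

Lemma lg_lt m n : (0 < m)%N -> (m < n)%N -> lg m < lg n.
Proof. by move=> m0 lt_mn; apply: lt_le_trans (lg_ltS m0) (lg_le _ lt_mn). Qed.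

Lemma lg_gt0 n : (1 < n)%N -> 0 < lg n.
Proof. by move=> n1; rewrite -lg1 lg_lt. Qed.

Lemma lg_le_inv m n : (0 < n)%N -> lg m <= lg n -> (m <= n)%N.
Proof.
move=> n0 le_mn; rewrite leqNgt; apply/negP => /(lg_lt n0).
by rewrite ltNge le_mn.
Qed.

Lemma lg_le_self n : (0 < n)%N -> lg n <= n%:R.
Proof.
move=> n0; have /ln_le_sub1 : (0 : R) < n%:R by rewrite ltr0n.
rewrite /lg; lra.
Qed.

Lemma lg_unbounded (c : R) : exists n : nat, (1 < n)%N /\ c <= lg n.
Proof.
have l2 : 0 < lg 2 by exact: lg_gt0.
pose k := (Num.bound `|c / lg 2|).+1; exists (2 ^ k)%N; split.
  by rewrite -{1}(expn0 2) ltn_exp2l.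
rewrite lgX // -ler_pdivrMr //; apply: le_trans (ler_norm _) _.
apply: ltW; apply: lt_trans (archi_boundP (normr_ge0 _)) _.
by rewrite ltr_nat.
Qed.

Lemma lg_prod (I : Type) (s : seq I) (P : pred I) (F : I -> nat) :
  (forall i, P i -> (0 < F i)%N) ->
  lg (\prod_(i <- s | P i) F i) = \sum_(i <- s | P i) lg (F i).
Proof.
move=> F0; elim: s => [|a s IHs]; first by rewrite !big_nil lg1.
rewrite !big_cons; case: ifP => // Pa.
by rewrite lgM ?IHs ?F0 // prodn_cond_gt0.
Qed.

Lemma prod_primes_dvd (s : seq nat) m :
  uniq s -> {in s, forall p, prime p && (p %| m)%N} ->
  (\prod_(p <- s) p %| m)%N.
Proof.
elim: s => [|p s IHs] /=; first by rewrite big_nil dvd1n.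
case/andP=> p_s us sP; rewrite big_cons Gauss_dvd.
  have /andP[_ ->] := sP p (mem_head _ _); apply: IHs => // r rs.
  by apply: sP; rewrite inE rs orbT.
rewrite big_seq; elim/big_rec: _ => [|r x rs cx]; first exact: coprimen1.
have /andP[pp _] := sP p (mem_head _ _).
have /andP[pr _] : prime r && (r %| m)%N by apply: sP; rewrite inE rs orbT.
rewrite coprimeMr cx andbT prime_coprime // dvdn_prime2 //.
by apply: contraNneq p_s => ->.
Qed.

Lemma harmonic_ge_lg n : lg n.+1 <= \sum_(1 <= k < n.+1) (k%:R^-1 : R).
Proof.
elim: n => [|n IHn]; first by rewrite lg1 big_geq.
rewrite big_nat_recr //=.
apply: (@le_trans _ _ (lg n.+1 + n.+1%:R^-1)); last by rewrite lerD2r.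
by rewrite -lerBlDl lg_diff_le.
Qed.

Lemma harmonic_le_lg n : (0 < n)%N ->
  \sum_(1 <= k < n.+1) (k%:R^-1 : R) <= 1 + lg n.
Proof.
elim: n => [//|[|n] IHn] _; first by rewrite big_nat1 lg1 invr1 addr0.
rewrite big_nat_recr //=.
apply: (@le_trans _ _ (1 + lg n.+1 + n.+2%:R^-1)).
  by rewrite lerD2r IHn.
by rewrite -addrA lerD2l -lerBrDl lg_diff_ge.
Qed.

Lemma sum_lg_div_le x : (0 < x)%N ->
  \sum_(1 <= m < x.+1) lg m / m%:R <= (lg x ^+ 2 + 1) / 2.
Proof.
move=> x0; have : \sum_(1 <= m < x.+1) lg m / m%:R <=
    lg x ^+ 2 / 2 + (1 - x%:R^-1) / 2; last first.
  have : (0 : R) <= x%:R^-1 by rewrite invr_ge0.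
  lra.
elim: x x0 => [//|[|x] IHx] _.
  by rewrite big_nat1 lg1 mul0r expr0n /= mul0r invr1 subrr mul0r addr0.
rewrite big_nat_recr //=; have := IHx isT.
have := @lg_diff_ge x.+1 isT; have := @lg_diff_le x.+1 isT.
have := @lg_ge0 x.+1 isT; have : (0 : R) < x.+1%:R by rewrite ltr0n.
rewrite -[x.+2%:R]natr1; move: (lg x.+1) (lg x.+2) (x.+1%:R : R) => a b y y0 a0.
move=> le1 ge1.
suff : b / (y + 1) <= (b ^+ 2 - a ^+ 2) / 2 + (y^-1 - (y + 1)^-1) / 2 by lra.
have -> : y^-1 - (y + 1)^-1 = y^-1 * (y + 1)^-1.
  by field; rewrite !gt_eqF ?ltr_wpDr.
have : 0 < (y + 1)^-1 by rewrite invr_gt0 ltr_wpDr.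
move: le1 ge1; move: (y^-1) ((y + 1)^-1) => u v le1 ge1 v0.
have : v * (a + b) <= (b - a) * (a + b) by rewrite ler_wpM2r //; lra.
have : v * (b - a) <= v * u by rewrite ler_wpM2l // ltW.
lra.
Qed.

Lemma sum_multiples p x (f : nat -> R) : (0 < p)%N ->
  \sum_(1 <= m < x.+1 | (p %| m)%N) f m =
  \sum_(1 <= k < (x %/ p).+1) f (p * k)%N.
Proof.
move=> p0; elim: x => [|x IHx]; first by rewrite div0n !big_geq.
rewrite divnS // big_mkcond big_nat_recr //= -big_mkcond IHx.
case: (boolP (p %| x.+1)%N) => d /=; last by rewrite add0n addr0.
rewrite add1n [RHS]big_nat_recr //=; congr (_ + f _).
by rewrite -{1}(divnK d) mulnC divnS // d add1n.
Qed.

Lemma lg_ge_prime_divisors n m : (0 < m)%N ->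
  \sum_(0 <= p < n | prime p && (p %| m)%N) lg p <= lg m.
Proof.
move=> m0; rewrite -lg_prod; last by move=> p /andP[/prime_gt0].
apply: lg_le; first by rewrite prodn_cond_gt0 // => p /andP[/prime_gt0].
apply: dvdn_leq => //; rewrite -big_filter prod_primes_dvd ?filter_uniq ?iota_uniq //.
by move=> p; rewrite mem_filter => /andP[].
Qed.

(* Counting [lg m / m] through the prime divisors of [m] replaces the usual
   appeal to Chebyshev's bound. *)
Lemma mertens_upper n D r : (0 < r <= D)%N ->
  \sum_(0 <= p < n | prime p)
     lg p / p%:R * Num.max 0 (lg D - lg r - lg p)
  <= ((lg D - lg r) ^+ 2 + 1) / 2.
Proof.
case/andP=> r0 rD; pose x := (D %/ r)%N.
have x0 : (0 < x)%N by rewrite divn_gt0.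
have D0 := leq_trans r0 rD.
have lgx : lg x <= lg D - lg r.
  rewrite lerBrDr -lgM // lg_le ?muln_gt0 ?x0 // leq_trunc_div //.
apply: (@le_trans _ _ ((lg x ^+ 2 + 1) / 2)); last first.
  rewrite ler_wpM2r ?invr_ge0 // lerD2r ler_pXn2r // nnegrE ?lg_ge0 //.
  by rewrite (le_trans _ lgx) ?lg_ge0.
apply: le_trans (sum_lg_div_le x0).
apply: (@le_trans _ _ (\sum_(1 <= m < x.+1) \sum_(0 <= p < n |
    prime p && (p %| m)%N) lg p / m%:R)); last first.
  rewrite !big_nat; apply: ler_sum => m /andP[m0 _].
  by rewrite -mulr_suml ler_wpM2r ?invr_ge0 // lg_ge_prime_divisors.
rewrite (exchange_big_dep prime) /=; last by move=> m p _ /andP[].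
apply: ler_sum => p pp; have p0 := prime_gt0 pp.
have -> : \sum_(1 <= m < x.+1 | prime p && (p %| m)%N) lg p / m%:R =
    lg p / p%:R * \sum_(1 <= k < (x %/ p).+1) (k%:R^-1 : R).
  rewrite (eq_bigl (fun m => (p %| m)%N)); last by move=> m; rewrite pp.
  rewrite sum_multiples // mulr_sumr; apply: eq_bigr => k _.
  by rewrite natrM invfM mulrA.
rewrite ler_wpM2l ?divr_ge0 ?lg_ge0 // ge_max; apply/andP; split.
  by apply: sumr_ge0 => k _; rewrite invr_ge0.
apply: le_trans (harmonic_ge_lg _).
suff : lg D <= lg (x %/ p).+1 + (lg r + lg p) by lra.
rewrite -!lgM // ?muln_gt0 ?r0 // lg_le // /x -divnMA ltnW // ltn_ceil //.
by rewrite muln_gt0 r0.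
Qed.

Lemma sum_inv_sqr_le a n : (0 < a)%N ->
  \sum_(a.+1 <= p < n) ((p%:R ^+ 2)^-1 : R) <= a%:R^-1.
Proof.
move=> a0; have a0R : 0 < a%:R :> R by rewrite ltr0n.
have [le_na | lt_an] := leqP n a; first by rewrite big_geq ?invr_ge0 ?ler0n // leqW.
suff : \sum_(a.+1 <= p < n) ((p%:R ^+ 2)^-1 : R) <= a%:R^-1 - n.-1%:R^-1.
  by move=> /le_trans; apply; rewrite gerBl invr_ge0 ler0n.
elim: n lt_an => [//|n IHn]; rewrite ltnS leq_eqVlt => /predU1P[<-|lt_an].
  by rewrite big_geq //= subrr.
rewrite big_nat_recr //=; apply: le_trans (lerD (IHn lt_an) (lexx _)) _.
case: n lt_an {IHn} => // n lt_an /=.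
have n0 : 0 < n%:R :> R by rewrite ltr0n; apply: leq_trans a0 lt_an.
rewrite -natr1; move: (n%:R : R) n0 (a%:R^-1) => x x0 b.
have -> : b - x^-1 + ((x + 1) ^+ 2)^-1 =
   b - (x + 1)^-1 - (x * (x + 1) ^+ 2)^-1.
  by field; rewrite !gt_eqF // ltr_wpDl // ltW.
by rewrite gerBl invr_ge0 mulr_ge0 ?sqr_ge0 // ltW.
Qed.

(** * The sieve *)

Definition lin (a t : nat) : nat := (a * t.+1).-1.

Definition twin (W t : nat) : nat := lin W t * lin (2 * W) t.

Lemma lin_shift a q t : (0 < a)%N -> lin a (t + q) = (lin a t + a * q)%N.
Proof. by move=> a0; rewrite /lin; nia. Qed.

Lemma lin_double W t : (0 < W)%N -> lin (2 * W) t = (2 * lin W t + 1)%N.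
Proof. by move=> W0; rewrite /lin; nia. Qed.

Lemma dvdn_lin_shift a q t : (0 < a)%N ->
  (q %| lin a (t + q))%N = (q %| lin a t)%N.
Proof. by move=> a0; rewrite lin_shift // dvdn_addl // dvdn_mull. Qed.

Lemma dvdn_twin_shift W p t : (0 < W)%N -> prime p ->
  (p %| twin W (t + p))%N = (p %| twin W t)%N.
Proof.
by move=> W0 pp; rewrite /twin !Euclid_dvdM // !dvdn_lin_shift // muln_gt0.
Qed.

Lemma lin_root a q : (0 < a)%N -> (0 < q)%N -> coprime q a ->
  exists t0 : 'I_q, forall t : 'I_q, (q %| lin a t)%N = (t == t0).
Proof.
case: q => // q a0 _ cop.
pose f (t : 'I_q.+1) : 'I_q.+1 := inord ((a * t.+1) %% q.+1).
have fE t : f t = ((a * t.+1) %% q.+1)%N :> nat by rewrite inordK ?ltn_mod.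
have inj_f : injective f.
  move=> i j /(congr1 (@nat_of_ord _)); rewrite !fE => /eqP eij.
  apply/val_inj => /=.
  have : (i == j %[mod q.+1])%N.
    wlog le_ij : i j eij / (i <= j)%N.
      move=> Hw; case: (leqP i j) => [|/ltnW] h1; first exact: Hw.
      by rewrite eq_sym; apply: Hw => //; rewrite eq_sym.
    rewrite eq_sym eqn_mod_dvd // -(@Gauss_dvdr _ a) // mulnBr.
    move: eij; rewrite eq_sym eqn_mod_dvd ?leq_mul2l ?ltnS ?le_ij ?orbT //.
    by rewrite !mulnS subnDl.
  by rewrite !modn_small // => /eqP.
exists (invF inj_f (inord (1 %% q.+1))) => t.
rewrite -(inj_eq inj_f) f_invF -val_eqE /= fE inordK ?ltn_mod //.
by rewrite eqn_mod_dvd ?muln_gt0 ?a0 // /lin subn1.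
Qed.

Lemma sum_twin_root W p (x y : R) : (0 < W)%N -> prime p -> coprime p (2 * W) ->
  \sum_(t < p) (if (p %| twin W t)%N then x else y) =
    p%:R * y + 2 * (x - y).
Proof.
move=> W0 pp cop; have p0 := prime_gt0 pp.
have copW : coprime p W by move: cop; rewrite coprimeMr => /andP[].
have [t1 t1E] := lin_root W0 p0 copW.
have [t2 t2E] : exists t0 : 'I_p, forall t : 'I_p,
    (p %| lin (2 * W) t)%N = (t == t0).
  by apply: lin_root; rewrite ?muln_gt0.
have n12 : t1 != t2.
  apply/eqP => e12; have d1 : (p %| lin W t1)%N by rewrite t1E.
  have : (p %| lin (2 * W) t1)%N by rewrite t2E e12.
  rewrite lin_double // dvdn_addr ?dvdn_mull // dvdn1 => /eqP p1.
  by rewrite p1 in pp.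
have delta (t0 : 'I_p) : \sum_(t < p) (if t == t0 then x - y else 0) = x - y.
  by rewrite -big_mkcond big_pred1_eq.
transitivity (\sum_(t < p) (y + ((if t == t1 then x - y else 0) +
     (if t == t2 then x - y else 0)))).
  apply: eq_bigr => t _; rewrite /twin Euclid_dvdM // t1E t2E.
  have [-> | _] := eqVneq t t1; first by rewrite (negPf n12) /=; ring.
  by case: eqP => /= _; ring.
by rewrite big_split /= big_split /= !delta sumr_const card_ord -mulr_natl; ring.
Qed.

Lemma count_lin_le a q N : (0 < a)%N -> (0 < q)%N -> coprime q a ->
  \sum_(t < N) ((q %| lin a t)%N%:R : R) <= N%:R / q%:R + 1.
Proof.
move=> a0 q0 cop; have q0R : 0 < q%:R :> R by rewrite ltr0n.
pose f t : R := (q %| lin a t)%N%:R.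
have fq : periodic q f by move=> t; rewrite /f dvdn_lin_shift.
have f1 : \sum_(j < q) f j = 1.
  have [t0 t0E] := lin_root a0 q0 cop.
  rewrite (bigD1 t0) //= /f t0E eqxx big1 ?addr0 // => t nt.
  by rewrite t0E (negPf nt).
have leN : (N <= (N %/ q).+1 * q)%N by rewrite ltnW // ltn_ceil.
apply: (@le_trans _ _ (\sum_(t < (N %/ q).+1 * q) f t)).
  rewrite (big_ord_widen _ f leN) big_mkcond /=.
  by apply: ler_sum => t _; case: ifP => // _; rewrite /f ler0n.
rewrite sum_blocks (eq_bigr (fun=> 1)); last first.
  move=> i _; rewrite -f1; apply: eq_bigr => j _.
  by rewrite addnC periodic_mulr.
rewrite sumr_const card_ord -natr1 lerD2r ler_pdivlMr // -natrM ler_nat.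
exact: leq_trunc_div.
Qed.

Lemma squarefree_prod_primes n : (0 < n)%N ->
  (forall p, prime p -> ~~ (p ^ 2 %| n)%N) -> (\prod_(p <- primes n) p = n)%N.
Proof.
move=> n0 sqf; rewrite [RHS](prod_prime_decomp n0) prime_decompE big_map /=.
rewrite !big_seq; apply: eq_bigr => p; rewrite mem_primes => /and3P[pp _ pn].
suff -> : logn p n = 1%N by rewrite expn1.
apply/eqP; rewrite eqn_leq -pfactor_dvdn // expn1 pn andbT leqNgt.
by rewrite -pfactor_dvdn // sqf.
Qed.

Lemma sub_max0_bounds (a b : R) : 0 <= a -> 0 <= b ->
  0 <= a - Num.max 0 (a - b) <= a /\ a - Num.max 0 (a - b) <= b.
Proof.
by move=> a0 b0; case: (lerP 0 (a - b)) => c; split; try (apply/andP; split); lra.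
Qed.

Lemma sum_subsets_setU1 (V : nmodType) (I : finType) (P : {set I}) (p : I)
    (f : {set I} -> V) : p \in P ->
  \sum_(A : {set I} | A \subset P) f A =
  \sum_(A : {set I} | A \subset P :\ p) (f A + f (p |: A)).
Proof.
move=> pP; rewrite (bigID (fun A : {set I} => p \in A)) /= addrC big_split /=.
congr (_ + _).
  by apply: eq_bigl => A; rewrite subsetD1.
rewrite (reindex_onto (fun A => p |: A) (fun A => A :\ p)) /=; last first.
  by move=> A /andP[_ pA]; exact: setD1K.
apply: eq_bigl => A; rewrite subsetD1 subUset sub1set pP setU11 andbT /=.
congr (_ && _); apply/eqP/idP => [<- | pA]; first by rewrite setD11.
exact: setU1K.
Qed.

Section SelbergWeights.
Variables (W w D : nat).
Hypothesis W_gt0 : (0 < W)%N.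
Hypothesis D_gt0 : (0 < D)%N.
Hypothesis w_ge : (22 <= w)%N.
Hypothesis lgw_ge : 10 <= lg w ^+ 2.
Hypothesis coprimeW : forall p, prime p -> (w < p)%N -> coprime p (2 * W).

Definition sieve_primes : {set 'I_D.+1} :=
  [set p : 'I_D.+1 | prime p && (w < p)%N].

Definition sieve_h (p : 'I_D.+1) : R := 2 / (p%:R - 2).

(* Has mean [0] and mean square [1 / sieve_h p] over a period. *)
Definition sieve_xi (p : 'I_D.+1) (t : nat) : R :=
  if (p %| twin W t)%N then - ((p%:R - 2) / 2) else 1.

Definition set_prod (A : {set 'I_D.+1}) : nat := (\prod_(p in A) p)%N.

Definition selberg_y (A : {set 'I_D.+1}) : R :=
  Num.max 0 (lg D - lg (set_prod A)).

Definition selberg_weight (t : nat) : R :=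
  \sum_(A : {set 'I_D.+1} | A \subset sieve_primes)
    (\prod_(p in A) sieve_h p) * selberg_y A * \prod_(p in A) sieve_xi p t.

Definition selberg_J : R :=
  \sum_(A : {set 'I_D.+1} | A \subset sieve_primes)
    (\prod_(p in A) sieve_h p) * selberg_y A ^+ 2.

Definition selberg_G : R :=
  \sum_(A : {set 'I_D.+1} | A \subset sieve_primes)
    (\prod_(p in A) sieve_h p) * selberg_y A.

Definition selberg_err : R :=
  \sum_(A : {set 'I_D.+1} | A \subset sieve_primes)
    (\prod_(p in A) sieve_h p) * `|selberg_y A| * \prod_(p in A) (2 * p)%:R.

Local Notation P := sieve_primes.
Local Notation h := sieve_h.
Local Notation xi := sieve_xi.
Local Notation y := selberg_y.
Local Notation s := (lg D).

Lemma sieve_primesP (p : 'I_D.+1) : p \in P -> [/\ prime p, (w < p)%N,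
  (23 <= p)%N & coprime p (2 * W)].
Proof.
rewrite inE => /andP[pp wp]; split=> //; last exact: coprimeW.
exact: leq_ltn_trans w_ge wp.
Qed.

Lemma sieve_primesR (p : 'I_D.+1) : p \in P -> 23 <= p%:R :> R.
Proof. by case/sieve_primesP => _ _ p23 _; rewrite ler_nat. Qed.

Lemma sieve_h_gt0 : {in P, forall p, 0 < h p}.
Proof.
by move=> p /sieve_primesR p23; rewrite divr_gt0 // subr_gt0; lra.
Qed.

Lemma sieve_h_le : {in P, forall p : 'I_D.+1, h p <= 11 / 5 / p%:R}.
Proof.
move=> p /sieve_primesR p23; rewrite /h; move: (p%:R : R) p23 => x x23.
have -> : 2 / (x - 2) = 11 / 5 / x - (x - 22) / (5 * (x * (x - 2))).
  by field; apply/andP; split; apply/eqP; lra.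
rewrite gerBl divr_ge0; nra.
Qed.

Lemma prod_h_ge0 (A : {set 'I_D.+1}) :
  A \subset P -> 0 <= \prod_(p in A) h p.
Proof.
by move=> sA; apply: prodr_ge0 => p pA; rewrite ltW // sieve_h_gt0 // (subsetP sA).
Qed.

Lemma selberg_y_ge0 A : 0 <= y A.
Proof. by rewrite /y le_max lexx. Qed.

Lemma set_prod_gt0 (A : {set 'I_D.+1}) : A \subset P -> (0 < set_prod A)%N.
Proof.
move=> sA; apply: prodn_cond_gt0 => p /(subsetP sA) /sieve_primesP[pp _ _ _].
exact: prime_gt0.
Qed.

Lemma selberg_y_le (A : {set 'I_D.+1}) : A \subset P -> y A <= s.
Proof.
move=> sA; rewrite /y ge_max lg_ge0 //= gerBl.
by rewrite lg_ge0 // set_prod_gt0.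
Qed.

Lemma selberg_y_eq0 A : (D < set_prod A)%N -> y A = 0.
Proof.
move=> lt_D; apply/max_idPl; rewrite subr_le0.
by rewrite lg_le // ltnW.
Qed.

Lemma selberg_y_setU1 (A : {set 'I_D.+1}) p : A \subset P -> p \in P ->
  p \notin A -> y (p |: A) = Num.max 0 (y A - lg p).
Proof.
move=> sA pP pA; have [pp _ _ _] := sieve_primesP pP.
have lgp : 0 <= lg p by rewrite lg_ge0 ?prime_gt0.
rewrite /y /set_prod big_setU1 //= -/(set_prod A).
rewrite lgM ?(prime_gt0 pp) ?set_prod_gt0 //; move: (lg (set_prod A)) (lg p) lgp (lg D) => a b b0 c.
by case: (lerP 0 (c - a)) => h1; case: lerP => h2; case: lerP => h3; lra.
Qed.

Lemma sieve_xi_periodic : {in P, forall p : 'I_D.+1, periodic p (xi p)}.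
Proof.
by move=> p /sieve_primesP[pp _ _ _] t; rewrite /xi dvdn_twin_shift.
Qed.

Lemma sum_sieve_xi : {in P, forall p : 'I_D.+1, \sum_(t < p) xi p t = 0}.
Proof.
move=> p pP; have [pp _ _ cop] := sieve_primesP pP.
by rewrite /xi sum_twin_root //; move: (p%:R : R) => x; field.
Qed.

Lemma sum_sieve_xi_sqr :
  {in P, forall p : 'I_D.+1, \sum_(t < p) xi p t ^+ 2 = p%:R / h p}.
Proof.
move=> p pP; have [pp _ _ cop] := sieve_primesP pP.
transitivity (\sum_(t < p) (if (p %| twin W t)%N
    then (- ((p%:R - 2) / 2)) ^+ 2 else 1 : R)).
  by apply: eq_bigr => t _; rewrite /xi; case: ifP; rewrite ?expr1n.
by rewrite sum_twin_root // /h invf_div; move: (p%:R : R) => x; field.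
Qed.

Lemma sum_norm_sieve_xi :
  {in P, forall p : 'I_D.+1, \sum_(t < p) `|xi p t| <= (2 * p)%:R}.
Proof.
move=> p pP; have [pp _ _ cop] := sieve_primesP pP.
have p23 := sieve_primesR pP.
have p2 : 0 <= ((p%:R - 2) / 2 : R) by move: (p%:R : R) p23 => x; lra.
have -> : \sum_(t < p) `|xi p t| = \sum_(t < p) (if (p %| twin W t)%N
    then ((p%:R - 2) / 2) else 1 : R).
  apply: eq_bigr => t _.
  by rewrite /xi; case: ifP; rewrite ?normr1 // normrN ger0_norm.
by rewrite sum_twin_root // natrM; move: (p%:R : R) p23 => x; lra.
Qed.

Lemma le_sieve_h_sqr :
  {in P, forall p : 'I_D.+1, p%:R / h p <= (2 * p)%:R ^+ 2 :> R}.
Proof.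
move=> p /sieve_primesR p23; rewrite /h invf_div natrM.
by move: (p%:R : R) p23 => x x23; nra.
Qed.

Lemma sieve_primes_coprime :
  {in P &, forall p q : 'I_D.+1, p != q -> coprime p q}.
Proof.
move=> p q /sieve_primesP[pp _ _ _] /sieve_primesP[pq _ _ _] npq.
by rewrite prime_coprime // dvdn_prime2.
Qed.

Lemma sum_weight_sqr_ge N :
  N%:R * selberg_J - 2 * selberg_err ^+ 2 <=
  \sum_(t < N) selberg_weight t ^+ 2.
Proof.
have h1 : {in P, forall p : 'I_D.+1, (0 < p)%N}.
  by move=> p /sieve_primesP[/prime_gt0].
have h2 : {in P, forall p : 'I_D.+1, coprime 1 p}.
  by move=> p _; exact: coprime1n.
have per1 : periodic 1 (fun=> 1 : R) by [].
have := @quad_form_estimate R _ (fun p : 'I_D.+1 => p : nat) h xi P 1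
  (fun=> 1) y h1 sieve_h_gt0 sieve_primes_coprime sieve_xi_periodic
  sum_sieve_xi sum_sieve_xi_sqr sum_norm_sieve_xi le_sieve_h_sqr isT h2 per1 N.
rewrite !big_ord1 normr1 !mulr1 divr1 -/selberg_J -/selberg_err.
rewrite (eq_bigr (fun t : 'I_N => selberg_weight t ^+ 2)); last first.
  by move=> t _; rewrite mul1r.
by rewrite ler_norml lerBrDr addrC => /andP[].
Qed.

(* On the roots of [p] the factor [xi p] is the constant [- 1 / h p], so the
   weight is again a combination of the orthogonal products, without [p]. *)
Lemma weight_at_root (p : 'I_D.+1) t : p \in P -> (p %| twin W t)%N ->
  selberg_weight t = \sum_(A : {set 'I_D.+1} | A \subset P :\ p)
     (\prod_(q in A) h q) * (y A - y (p |: A)) * \prod_(q in A) xi q t.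
Proof.
move=> pP hit; rewrite /selberg_weight (sum_subsets_setU1 _ pP).
apply: eq_bigr => A; rewrite subsetD1 => /andP[sA pA].
rewrite !big_setU1 //=.
have -> : xi p t = - (h p)^-1 by rewrite /xi hit /h invf_div.
have : h p != 0 by rewrite gt_eqF ?sieve_h_gt0.
move: (\prod_(q in A) h q) (\prod_(q in A) xi q t) (h p) => a b c c0.
by field.
Qed.

Lemma sum_weight_sqr_root_le (p : 'I_D.+1) N : p \in P ->
  \sum_(t < N) (p %| twin W t)%N%:R * selberg_weight t ^+ 2 <=
  N%:R * (2 / p%:R) * (lg p * selberg_G) + 4 * selberg_err ^+ 2.
Proof.
move=> pP; have [pp _ _ cop] := sieve_primesP pP.
have lgp : 0 <= lg p by rewrite lg_ge0 ?prime_gt0.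
have subP : {subset P :\ p <= P} by move=> q /setD1P[].
pose phi t : R := (p %| twin W t)%N%:R.
pose Z A := y A - y (p |: A).
have phi_sum : \sum_(t < p) phi t = 2.
  transitivity (\sum_(t < p) (if (p %| twin W t)%N then 1 else 0 : R)).
    by apply: eq_bigr => t _; rewrite /phi; case: (_ %| _)%N.
  by rewrite sum_twin_root //; ring.
have phi_norm : \sum_(t < p) `|phi t| = 2.
  by rewrite -phi_sum; apply: eq_bigr => t _; rewrite ger0_norm // ler0n.
have h1 : {in P :\ p, forall p : 'I_D.+1, (0 < p)%N}.
  by move=> q /subP /sieve_primesP[/prime_gt0].
have h2 : {in P :\ p, forall q : 'I_D.+1, coprime p q}.
  move=> q /setD1P[nqp qP]; apply: sieve_primes_coprime => //.
  by rewrite eq_sym.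
have phip : periodic p phi by move=> t; rewrite /phi dvdn_twin_shift.
have := @quad_form_estimate R _ (fun p : 'I_D.+1 => p : nat) h xi (P :\ p) p
  phi Z h1 (sub_in1 subP sieve_h_gt0) (sub_in2 subP sieve_primes_coprime)
  (sub_in1 subP sieve_xi_periodic) (sub_in1 subP sum_sieve_xi)
  (sub_in1 subP sum_sieve_xi_sqr) (sub_in1 subP sum_norm_sieve_xi)
  (sub_in1 subP le_sieve_h_sqr) (prime_gt0 pp) h2 phip N.
rewrite phi_sum phi_norm.
have -> : \sum_(t < N) phi t * (\sum_(A : {set 'I_D.+1} | A \subset P :\ p)
     \prod_(i in A) h i * Z A * \prod_(i in A) xi i t) ^+ 2 =
   \sum_(t < N) (p %| twin W t)%N%:R * selberg_weight t ^+ 2.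
  apply: eq_bigr => t _; rewrite /phi.
  case: (boolP (p %| twin W t)%N) => hit; last by rewrite !mul0r.
  by rewrite (weight_at_root pP hit).
have Zb (A : {set 'I_D.+1}) : A \subset P :\ p -> 0 <= Z A <= y A /\ Z A <= lg p.
  rewrite subsetD1 => /andP[sA pA]; rewrite /Z selberg_y_setU1 //.
  exact: sub_max0_bounds (selberg_y_ge0 A) lgp.
have sub_sum (f : {set 'I_D.+1} -> R) :
    (forall A : {set 'I_D.+1}, A \subset P -> 0 <= f A) ->
    \sum_(A : {set 'I_D.+1} | A \subset P :\ p) f A <=
    \sum_(A : {set 'I_D.+1} | A \subset P) f A.
  move=> f0; rewrite [leRHS](bigID (fun A : {set 'I_D.+1} => p \notin A)) /=.
  rewrite (eq_bigl (fun A : {set 'I_D.+1} => (A \subset P) && (p \notin A))).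
    by rewrite lerDl sumr_ge0 // => A /andP[sA _]; exact: f0.
  by move=> A; rewrite subsetD1.
have sP (A : {set 'I_D.+1}) : A \subset P :\ p -> A \subset P.
  by rewrite subsetD1 => /andP[].
have main_le : \sum_(A : {set 'I_D.+1} | A \subset P :\ p)
    \prod_(i in A) h i * Z A ^+ 2 <= lg p * selberg_G.
  rewrite /selberg_G mulr_sumr.
  apply: le_trans (sub_sum _ _); last first.
    by move=> A sA; rewrite mulr_ge0 // mulr_ge0 ?selberg_y_ge0 ?prod_h_ge0.
  apply: ler_sum => A sA; rewrite [leRHS]mulrCA ler_wpM2l ?prod_h_ge0 ?sP //.
  by have [/andP[z0 zy] zl] := Zb A sA; rewrite expr2 ler_pM.
have err_le : \sum_(A : {set 'I_D.+1} | A \subset P :\ p)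
     \prod_(i in A) h i * `|Z A| * \prod_(i in A) (2 * i)%:R <= selberg_err.
  rewrite /selberg_err; apply: le_trans (sub_sum _ _); last first.
    by move=> A sA; rewrite !mulr_ge0 ?prod_h_ge0 // prodr_ge0.
  apply: ler_sum => A sA; rewrite ler_wpM2r ?prodr_ge0 //.
  rewrite ler_wpM2l ?prod_h_ge0 ?sP //.
  have [/andP[z0 zy] _] := Zb A sA.
  by rewrite !ger0_norm ?selberg_y_ge0.
have err0 : 0 <= \sum_(A : {set 'I_D.+1} | A \subset P :\ p)
     \prod_(i in A) h i * `|Z A| * \prod_(i in A) (2 * i)%:R.
  by apply: sumr_ge0 => A sA; rewrite !mulr_ge0 ?prod_h_ge0 ?sP // prodr_ge0.
move: main_le err_le err0; set u := \sum_(A | _) _; set v := \sum_(A | _) _.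
move=> uG ve v0; rewrite ler_norml lerBlDl => /andP[_] /le_trans; apply.
rewrite -(mulrA _ _ 2) (mulrC _ 2); apply: lerD.
  by rewrite ler_wpM2l // mulr_ge0 ?divr_ge0.
have -> : 2 * 2 = 4 :> R by ring.
by rewrite ler_wpM2l // ler_pXn2r // nnegrE // (le_trans v0).
Qed.

Lemma sum_sieve_primes_le (f : nat -> R) : (forall p, prime p -> 0 <= f p) ->
  \sum_(p in P) f p <= \sum_(0 <= p < D.+1 | prime p) f p.
Proof.
move=> f0; rewrite big_mkord [leRHS](bigID (fun p : 'I_D.+1 => p \in P)) /=.
rewrite (eq_bigl (fun p : 'I_D.+1 => prime p && (p \in P))).
  by rewrite lerDl sumr_ge0 // => p /andP[pp _]; exact: f0.
by move=> p; rewrite inE andbA andbb.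
Qed.

(* The sum is empty unless the cutoff exceeds [w], and then the additive
   constant of [mertens_upper] is absorbed by the main term. *)
Lemma sum_sieve_h_lg_le r : (0 < r <= D)%N ->
  \sum_(p in P) h p * lg p * Num.max 0 (s - lg r - lg p)
    <= 121 / 100 * (s - lg r) ^+ 2.
Proof.
move=> rD; have := mertens_upper D.+1 rD; set x := s - lg r => mert.
have [x_le | x_gt] := leP x (lg w).
  rewrite big1 => [|p pP]; first by rewrite mulr_ge0 ?divr_ge0 ?ler0n ?sqr_ge0.
  have [pp wp _ _] := sieve_primesP pP.
  rewrite (max_idPl _) ?mulr0 // subr_le0 (le_trans x_le) // lg_le //.
    by apply: leq_trans w_ge.
  exact: ltnW.
apply: (@le_trans _ _ (11 / 5 * ((x ^+ 2 + 1) / 2))); last first.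
  have : 10 <= x ^+ 2.
    apply: le_trans lgw_ge _; rewrite ler_pXn2r ?nnegrE ?ltW //.
      by rewrite lg_gt0 //; apply: leq_trans w_ge.
    by apply: le_lt_trans x_gt; rewrite lg_ge0 //; apply: leq_trans w_ge.
  move: (x ^+ 2) => z; lra.
apply: (@le_trans _ _ (11 / 5 * \sum_(p in P)
    lg p / p%:R * Num.max 0 (x - lg p))).
  rewrite mulr_sumr; apply: ler_sum => p pP.
  have [pp _ _ _] := sieve_primesP pP.
  rewrite mulrA ler_wpM2r ?le_max ?lexx // mulrA (mulrAC _ (lg p)).
  by rewrite ler_wpM2r ?lg_ge0 ?prime_gt0 // sieve_h_le.
rewrite ler_wpM2l ?divr_ge0 ?ler0n //; apply: le_trans mert.
apply: (@sum_sieve_primes_le (fun p => lg p / p%:R * Num.max 0 (x - lg p))).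
by move=> p pp; rewrite mulr_ge0 ?divr_ge0 ?lg_ge0 ?prime_gt0 // le_max lexx.
Qed.

Lemma lg_set_prod (A : {set 'I_D.+1}) : A \subset P ->
  lg (set_prod A) = \sum_(p in A) lg p.
Proof.
move=> sA; apply: lg_prod => p /(subsetP sA) /sieve_primesP[pp _ _ _].
exact: prime_gt0.
Qed.

Lemma selberg_G_le : s * selberg_G <= 221 / 100 * selberg_J.
Proof.
have -> : s * selberg_G = selberg_J + \sum_(A : {set 'I_D.+1} | A \subset P)
    \sum_(p in A) (\prod_(q in A) h q) * y A * lg p.
  rewrite /selberg_G /selberg_J mulr_sumr -big_split /=; apply: eq_bigr => A sA.
  rewrite -mulr_sumr -lg_set_prod // /y; case: lerP => _; first by ring.
  by rewrite expr0n /= !(mulr0, mul0r) addr0.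
suff : \sum_(A : {set 'I_D.+1} | A \subset P)
    \sum_(p in A) (\prod_(q in A) h q) * y A * lg p <=
    121 / 100 * selberg_J by lra.
have -> : \sum_(A : {set 'I_D.+1} | A \subset P)
    \sum_(p in A) (\prod_(q in A) h q) * y A * lg p =
  \sum_(p in P) \sum_(A : {set 'I_D.+1} | A \subset P :\ p)
    h p * (\prod_(q in A) h q) * Num.max 0 (y A - lg p) * lg p.
  rewrite (exchange_big_dep (fun p => p \in P)) /=; last first.
    by move=> A p /subsetP sA /sA.
  apply: eq_bigr => p pP.
  rewrite big_mkcondr (sum_subsets_setU1 (fun A : {set 'I_D.+1} =>
    if p \in A then (\prod_(q in A) h q) * y A * lg p else 0) pP).
  apply: eq_bigr => A; rewrite subsetD1 => /andP[sA pA].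
  by rewrite (negPf pA) setU11 add0r big_setU1 //= selberg_y_setU1.
apply: (@le_trans _ _ (\sum_(A : {set 'I_D.+1} | A \subset P)
   \prod_(q in A) h q * \sum_(p in P) h p * lg p * Num.max 0 (y A - lg p))).
  rewrite (eq_bigr (fun A : {set 'I_D.+1} => \sum_(p in P)
    h p * (\prod_(q in A) h q) * Num.max 0 (y A - lg p) * lg p)); last first.
    by move=> A _; rewrite mulr_sumr; apply: eq_bigr => p _; ring.
  rewrite [leRHS]exchange_big /=; apply: ler_sum => p pP.
  rewrite [leRHS](bigID (fun A : {set 'I_D.+1} => p \notin A)) /=.
  rewrite (eq_bigl (fun A : {set 'I_D.+1} => (A \subset P) && (p \notin A))).
    rewrite lerDl sumr_ge0 // => A /andP[sA _]; have [pp _ _ _] := sieve_primesP pP.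
    have hp := ltW (sieve_h_gt0 pP).
    rewrite mulr_ge0 ?lg_ge0 ?prime_gt0 // mulr_ge0 ?le_max ?lexx //.
    by rewrite mulr_ge0 ?prod_h_ge0.
  by move=> A; rewrite subsetD1.
rewrite /selberg_J mulr_sumr; apply: ler_sum => A sA.
rewrite [leRHS]mulrCA ler_wpM2l ?prod_h_ge0 //.
have [ltD | leD] := ltnP D (set_prod A).
  rewrite selberg_y_eq0 // expr0n /= mulr0 big1 // => p pP.
  have [pp _ _ _] := sieve_primesP pP.
  by rewrite (max_idPl _) ?mulr0 // sub0r oppr_le0 lg_ge0 ?prime_gt0.
have -> : y A = s - lg (set_prod A).
  by apply/max_idPr; rewrite subr_ge0 lg_le ?set_prod_gt0.
by apply: sum_sieve_h_lg_le; rewrite set_prod_gt0.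
Qed.

Lemma selberg_J_ge : s ^+ 2 <= selberg_J.
Proof.
rewrite /selberg_J (bigD1 set0) ?sub0set //= big_set0 mul1r.
have -> : y set0 = s.
  by rewrite /y /set_prod big_set0 lg1 subr0; apply/max_idPr; exact: lg_ge0.
rewrite lerDl sumr_ge0 // => A /andP[sA _].
by rewrite mulr_ge0 ?prod_h_ge0 ?sqr_ge0.
Qed.

Lemma set_prod_inj : {in [set A : {set 'I_D.+1} | A \subset P] &, injective set_prod}.
Proof.
have mem_dvd (A : {set 'I_D.+1}) p : A \subset P -> p \in P ->
    (p \in A) = (p %| set_prod A)%N.
  move=> sA pP; have [pp _ _ _] := sieve_primesP pP.
  have [pA | pA] := boolP (p \in A).
    by rewrite /set_prod (bigD1 p) //= dvdn_mulr.
  apply/esym/negbTE; rewrite -prime_coprime //.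
  rewrite /set_prod; elim/big_rec: _ => [|q x qA cx]; first exact: coprimen1.
  have qP := subsetP sA q qA.
  rewrite coprimeMr cx andbT sieve_primes_coprime //.
  by apply: contraNneq pA => ->.
move=> A B; rewrite !inE => sA sB eAB; apply/setP => p.
have [pP | npP] := boolP (p \in P).
  by rewrite (mem_dvd A p sA pP) (mem_dvd B p sB pP) eAB.
have -> : p \in A = false by apply: contraNF npP => /(subsetP sA).
by apply/esym; apply: contraNF npP => /(subsetP sB).
Qed.

Lemma sum_set_prod_le (f : nat -> R) : (forall n, 0 <= f n) ->
  \sum_(A : {set 'I_D.+1} | (A \subset P) && (set_prod A <= D)%N) f (set_prod A)
  <= \sum_(1 <= r < D.+1) f r.
Proof.
move=> f0; pose S := [set A : {set 'I_D.+1} | (A \subset P) && (set_prod A <= D)%N].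
pose k (A : {set 'I_D.+1}) : 'I_D.+1 := inord (set_prod A).
have kE A : A \in S -> k A = set_prod A :> nat.
  by rewrite inE => /andP[_ leD]; rewrite inordK.
have inj_k : {in S &, injective k}.
  move=> A B AS BS /(congr1 (@nat_of_ord _)); rewrite !kE //.
  move: AS BS; rewrite !inE => /andP[sA _] /andP[sB _].
  by apply: set_prod_inj; rewrite inE.
have -> : \sum_(A : {set 'I_D.+1} | (A \subset P) && (set_prod A <= D)%N)
    f (set_prod A) = \sum_(r in k @: S) f r.
  rewrite big_imset //=; apply: eq_big => A; first by rewrite inE.
  by move=> AS; rewrite kE // inE.
rewrite big_geq_mkord /= [leRHS](bigID (fun r : 'I_D.+1 => r \in k @: S)) /=.
rewrite (eq_bigl (fun r : 'I_D.+1 => (0 < r)%N && (r \in k @: S))).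
  by rewrite lerDl sumr_ge0.
move=> r; apply/idP/andP => [rS | []//]; split=> //.
have /imsetP[A AS ->] := rS; rewrite kE //.
by move: AS; rewrite inE => /andP[sA _]; exact: set_prod_gt0.
Qed.

Section SizeBounds.
Variables (m k : nat).
Hypothesis m_gt0 : (0 < m)%N.
Hypothesis lgD : lg D = (40 * k)%:R * lg m.
Hypothesis lgw : (40 * k)%:R * lg 5 <= lg w.

Lemma lg_card_le (A : {set 'I_D.+1}) : A \subset P ->
  (40 * k)%:R * lg (5 ^ #|A|) <= lg (set_prod A).
Proof.
move=> sA; rewrite lg_set_prod // lgX // mulrCA mulr_natl -sumr_const.
apply: ler_sum => p /(subsetP sA) /sieve_primesP[pp wp _ _].
apply: le_trans lgw _; apply: lg_le; last exact: ltnW.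
by apply: leq_trans w_ge.
Qed.

Lemma pow5_card_le (A : {set 'I_D.+1}) c : (0 < k)%N -> A \subset P ->
  lg (set_prod A) <= (40 * k)%:R * (c%:R * lg m) -> (5 ^ #|A| <= m ^ c)%N.
Proof.
move=> k0 sA le_c; apply: lg_le_inv; first by rewrite expn_gt0 m_gt0.
rewrite (lgX c) // -(@ler_pM2l _ (40 * k)%:R) ?ltr0n ?muln_gt0 //.
exact: le_trans (lg_card_le sA) le_c.
Qed.

Lemma pow5_card_le1 (A : {set 'I_D.+1}) : (0 < k)%N -> A \subset P ->
  (set_prod A <= D)%N -> (5 ^ #|A| <= m)%N.
Proof.
move=> k0 sA leD; rewrite -[leqRHS]expn1; apply: pow5_card_le => //.
by rewrite mul1r -lgD lg_le // set_prod_gt0.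
Qed.

Lemma selberg_err_le : (0 < k)%N -> selberg_err <= s * (m * D)%:R.
Proof.
move=> k0; rewrite /selberg_err.
rewrite (bigID (fun A : {set 'I_D.+1} => (set_prod A <= D)%N)) /=.
rewrite [X in _ + X]big1 ?addr0; last first.
  by move=> A /andP[_]; rewrite -ltnNge => /selberg_y_eq0 ->; rewrite normr0 mulr0 mul0r.
apply: (@le_trans _ _ (\sum_(A : {set 'I_D.+1} | (A \subset P) &&
    (set_prod A <= D)%N) s * m%:R)).
  apply: ler_sum => A /andP[sA leD]; rewrite mulrAC mulrC.
  rewrite -big_split /= ger0_norm ?selberg_y_ge0 //.
  rewrite ler_pM ?selberg_y_ge0 ?selberg_y_le //.
    apply: prodr_ge0 => p pA; rewrite mulr_ge0 ?ler0n //.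
    by rewrite ltW // sieve_h_gt0 // (subsetP sA).
  apply: (@le_trans _ _ (5 ^ #|A|)%:R); last first.
    by rewrite ler_nat pow5_card_le1.
  rewrite natrX -prodr_const; apply: ler_prod => p /(subsetP sA) pP.
  rewrite mulr_ge0 ?ler0n ?(ltW (sieve_h_gt0 pP)) //=.
  have := sieve_h_le pP; have := sieve_primesR pP; rewrite natrM.
  move: (p%:R : R) (h p) => x z x23 zx.
  have : z * (2 * x) <= 11 / 5 / x * (2 * x) by rewrite ler_wpM2r //; lra.
  have -> : 11 / 5 / x * (2 * x) = 22 / 5 by field; apply/eqP; lra.
  lra.
have sm0 : 0 <= s * m%:R by rewrite mulr_ge0 ?lg_ge0 ?ler0n.
apply: le_trans (sum_set_prod_le (f := fun=> s * m%:R) _) _ => //.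
rewrite sumr_const_nat subn1 /= -mulr_natr natrM; lra.
Qed.

Lemma sum_prod_h_le : (0 < k)%N ->
  \sum_(A : {set 'I_D.+1} | (A \subset P) && (set_prod A <= D)%N)
     \prod_(p in A) h p <= m%:R * (1 + s).
Proof.
move=> k0; apply: (@le_trans _ _ (\sum_(A : {set 'I_D.+1} | (A \subset P) &&
    (set_prod A <= D)%N) m%:R / (set_prod A)%:R)).
  apply: ler_sum => A /andP[sA leD].
  apply: (@le_trans _ _ ((5 ^ #|A|)%:R / (set_prod A)%:R)); last first.
    by rewrite ler_wpM2r ?invr_ge0 ?ler0n // ler_nat pow5_card_le1.
  rewrite natrX -prodr_const /set_prod natr_prod -prodfV -big_split /=.
  apply: ler_prod => p /(subsetP sA) pP; rewrite (ltW (sieve_h_gt0 pP)) /=.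
  apply: le_trans (sieve_h_le pP) _; rewrite ler_wpM2r ?invr_ge0 ?ler0n //; lra.
apply: le_trans (sum_set_prod_le (f := fun r => m%:R / r%:R) _) _.
  by move=> r; rewrite divr_ge0 ?ler0n.
by rewrite -mulr_sumr ler_wpM2l ?ler0n // harmonic_le_lg.
Qed.

(* [h p * `|xi p t|] is [1] when [p] divides [twin W t] and [h p] otherwise. *)
Lemma selberg_weight_le t : (0 < k)%N -> lg (twin W t) <= (262 * k)%:R * lg m ->
  (0 < twin W t)%N -> `|selberg_weight t| <= s * (m ^ 8)%:R * (1 + s).
Proof.
move=> k0 le_t t0.
pose X := [set p in P | (p %| twin W t)%N].
have sXP : X \subset P by apply/subsetP => p; rewrite inE => /andP[].
pose S := [set A : {set 'I_D.+1} | (A \subset P) && (set_prod A <= D)%N].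
pose H := \sum_(A in S) \prod_(p in A) h p.
have H0 : 0 <= H.
  by apply: sumr_ge0 => A; rewrite inE => /andP[sA _]; exact: prod_h_ge0.
have leH : H <= m%:R * (1 + s).
  apply: le_trans (sum_prod_h_le k0); rewrite /H.
  by rewrite (eq_bigl _ _ (in_set _)).
have cardX : ((2 ^ #|X|)%N <= m ^ 7)%N.
  apply: (@leq_trans (5 ^ #|X|)); first by elim: #|X| => // n IHn; rewrite !expnS leq_mul.
  apply: pow5_card_le => //; apply: (@le_trans _ _ (lg (twin W t))).
    apply: lg_le; first exact: set_prod_gt0.
    apply: dvdn_leq => //.
    rewrite /set_prod -big_enum -(big_map (@nat_of_ord _) xpredT id) /=.
    apply: prod_primes_dvd; first by rewrite (map_inj_uniq val_inj) enum_uniq.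
    move=> p /mapP[q]; rewrite mem_enum inE => /andP[qP qd] ->.
    by have [-> _ _ _] := sieve_primesP qP.
  apply: le_trans le_t _; rewrite mulrA ler_wpM2r ?lg_ge0 //.
  by rewrite -natrM ler_nat; lia.
have -> : selberg_weight t = \sum_(A in S)
    \prod_(p in A) h p * y A * \prod_(p in A) xi p t.
  rewrite /selberg_weight (bigID (fun A : {set 'I_D.+1} => (set_prod A <= D)%N)) /=.
  rewrite [X in _ + X]big1 ?addr0; first by apply: eq_bigl => A; rewrite inE.
  by move=> A /andP[_]; rewrite -ltnNge => /selberg_y_eq0 ->; rewrite mulr0 mul0r.
apply: le_trans (ler_norm_sum _ _ _) _.
apply: (@le_trans _ _ (s * \sum_(A in S) \prod_(p in A :\: X) h p)).
  rewrite mulr_sumr; apply: ler_sum => A; rewrite inE => /andP[sA leD].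
  rewrite !normrM (ger0_norm (selberg_y_ge0 A)) mulrAC mulrC.
  rewrite ler_pM ?selberg_y_ge0 ?selberg_y_le ?mulr_ge0 //.
  rewrite !normr_prod -big_split /= le_eqVlt; apply/orP; left; apply/eqP.
  rewrite (big_setID X) /= [X in X * _]big1 ?mul1r.
    apply: eq_bigr => p /setDP[pA pX]; have pP := subsetP sA p pA.
    move: pX; rewrite inE pP /= /xi => /negPf ->.
    by rewrite normr1 mulr1 gtr0_norm // sieve_h_gt0.
  move=> p /setIP[pA]; rewrite inE => /andP[pP pd].
  rewrite -normrM /xi pd /h; have := sieve_primesR pP.
  move: (p%:R : R) => x x23.
  have -> : 2 / (x - 2) * - ((x - 2) / 2) = -1 by field; apply/eqP; lra.
  by rewrite normrN1.
have le2 : \sum_(A in S) \prod_(p in A :\: X) h p <= (2 ^ #|X|)%:R * H.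
  rewrite (partition_big (fun A => A :&: X) (fun B => B \in powerset X)) /=.
    apply: (@le_trans _ _ (\sum_(B in powerset X) H)); last first.
      by rewrite sumr_const card_powerset mulr_natl lexx.
    apply: ler_sum => B _.
    pose SB := [set A in S | A :&: X == B].
    have -> : \sum_(A in S | A :&: X == B) \prod_(p in A :\: X) h p =
        \sum_(C in (fun A => A :\: X) @: SB) \prod_(p in C) h p.
      rewrite big_imset /=; first by apply: eq_bigl => A; rewrite [RHS]in_set.
      move=> A A'; rewrite !inE => /andP[_ /eqP eA] /andP[_ /eqP eA'] eD.
      by rewrite -(setID A X) -(setID A' X) eA eA' eD.
    rewrite /H [leRHS](bigID (fun C => C \in (fun A => A :\: X) @: SB)) /=.
    rewrite (eq_bigl (fun C => (C \in S) && (C \in (fun A => A :\: X) @: SB))).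
      rewrite lerDl sumr_ge0 // => C /andP[]; rewrite inE => /andP[sC _] _.
      exact: prod_h_ge0.
    move=> C; apply/idP/andP => [CS | []//]; split=> //.
    have /imsetP[A AS ->] := CS; move: AS; rewrite !inE => /andP[/andP[sA leD] _].
    have sDA : A :\: X \subset P by apply: subset_trans sA; exact: subsetDl.
    rewrite sDA /=; apply: leq_trans leD; apply: dvdn_leq; first exact: set_prod_gt0.
    by rewrite /set_prod [X in (_ %| X)%N](big_setID X) /= dvdn_mull.
  by move=> A _; rewrite inE subsetIr.
rewrite -mulrA ler_wpM2l ?lg_ge0 //; apply: le_trans le2 _.
rewrite expnSr natrM -mulrA ler_pM ?ler0n // ler_nat //.
Qed.

Hypothesis k_ge : (22 <= k)%N.
Hypothesis DE : D = (m ^ (40 * k))%N.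
Hypothesis m_ge1000 : (1000 <= m)%N.
Hypothesis m_gek : (40 * k + 1 <= m)%N.
Hypothesis W_le : (2 * W <= m ^ k)%N.
Hypothesis W_ge3 : (3 <= W)%N.
Hypothesis W_dvd : forall p, prime p -> (p <= w)%N -> (p %| W)%N.

Local Notation N := (m ^ (130 * k))%N.
Local Notation M := (m ^ k)%N.
(* [B] plus [262 / 40], a bound for [lg (twin W t) / lg D], equals [10]. *)
Local Notation B := (69 / 20 : R).

Let k_gt0 : (0 < k)%N. Proof. exact: leq_trans k_ge. Qed.

Lemma lg_m_ge : 1 / 2 <= lg m.
Proof.
have := @lg_diff_ge 1 isT; rewrite lg1 subr0.
have : lg 2 <= lg m by apply: lg_le => //; apply: leq_trans m_ge1000.
lra.
Qed.

Lemma lg_D_ge : 440 <= s.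
Proof.
rewrite lgD; have : 880 <= (40 * k)%:R :> R by rewrite ler_nat; lia.
have := lg_m_ge; move: (lg m) ((40 * k)%:R : R) => x z; nra.
Qed.

Lemma lg_D_le : 1 + s <= (m ^ 2)%:R.
Proof.
rewrite lgD; have := lg_le_self m_gt0.
have : (40 * k)%:R + 1 <= m%:R :> R by rewrite natr1 -addn1 ler_nat.
have : 1 <= m%:R :> R by rewrite ler1n.
have : 0 <= (40 * k)%:R :> R by rewrite ler0n.
rewrite natrX; move: (lg m) ((40 * k)%:R : R) (m%:R : R) => x z u; nra.
Qed.

(* Dominates the contribution of [p] to the number of prime factors, up to a
   multiple of [lg p]; a prime [p <= M] alone already exhausts the budget [B]. *)
Definition prime_cost (p : nat) : R :=
  1 - lg p / s + (if (p <= M)%N then B else 0).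

Lemma prime_cost_bounds (p : 'I_D.+1) : p \in P ->
  [/\ 0 <= 1 - lg p / s, 0 <= prime_cost p & prime_cost p <= 5].
Proof.
move=> pP; have [pp _ _ _] := sieve_primesP pP.
have s0 : 0 < s by apply: lt_le_trans lg_D_ge.
have lp0 : 0 <= lg p by rewrite lg_ge0 ?prime_gt0.
have d0 : 0 <= lg p / s by rewrite divr_ge0 // ltW.
have d1 : lg p / s <= 1.
  by rewrite ler_pdivrMr // mul1r lg_le ?(prime_gt0 pp) // -ltnS.
move: d0 d1; rewrite /prime_cost; move: (lg p / s) => x d0 d1.
by case: ifP => _; split; lra.
Qed.

Lemma sum_prime_cost_le :
  \sum_(p in P) prime_cost p * (2 / p%:R * lg p) <= 1346 / 1000 * s.
Proof.
have s440 := lg_D_ge; have s0 : 0 < s by apply: lt_le_trans s440.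
have sum1 : \sum_(p in P) lg p / p%:R * (s - lg p) <= (s ^+ 2 + 1) / 2.
  have := @mertens_upper D.+1 D 1; rewrite lg1 subr0 D_gt0 => /(_ isT).
  apply: le_trans.
  apply: le_trans (@sum_sieve_primes_le
    (fun p => lg p / p%:R * Num.max 0 (s - lg p)) _); last first.
    by move=> p pp; rewrite mulr_ge0 ?divr_ge0 ?lg_ge0 ?prime_gt0 // le_max lexx.
  apply: ler_sum => p pP; have [pp _ _ _] := sieve_primesP pP.
  by rewrite ler_wpM2l ?divr_ge0 ?lg_ge0 ?prime_gt0 // le_max lexx orbT.
have lgM0 : 0 < lg M by rewrite lgX // mulr_gt0 ?ltr0n //; have := lg_m_ge; lra.
have lgME : s = 40 * lg M by rewrite lgX // lgD natrM; ring.
have sum2 : \sum_(p in P) (if (p <= M)%N then lg p / p%:R else 0) <= s / 20 + 20 / s.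
  have := @mertens_upper D.+1 (M ^ 2) 1.
  rewrite lg1 subr0 !expn_gt0 m_gt0 => /(_ isT); rewrite lgX ?expn_gt0 ?m_gt0 //.
  move=> mert; rewrite -(ler_pM2l lgM0) mulr_sumr.
  have -> : lg M * (s / 20 + 20 / s) = ((2%:R * lg M) ^+ 2 + 1) / 2.
    by rewrite lgME; field; rewrite gt_eqF.
  apply: le_trans mert; apply: le_trans (@sum_sieve_primes_le
    (fun p => lg p / p%:R * Num.max 0 (2%:R * lg M - lg p)) _); last first.
    by move=> p pp; rewrite mulr_ge0 ?divr_ge0 ?lg_ge0 ?prime_gt0 // le_max lexx.
  apply: ler_sum => p pP; have [pp _ _ _] := sieve_primesP pP.
  have lp0 : 0 <= lg p / p%:R by rewrite divr_ge0 ?lg_ge0 ?prime_gt0.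
  case: ifP => pM; last by rewrite mulr0 mulr_ge0 ?le_max ?lexx.
  rewrite mulrC ler_wpM2l // le_max; apply/orP; right.
  have : lg p <= lg M by rewrite lg_le ?prime_gt0.
  lra.
have -> : \sum_(p in P) prime_cost p * (2 / p%:R * lg p) =
   2 / s * \sum_(p in P) lg p / p%:R * (s - lg p) +
   2 * B * \sum_(p in P) (if (p <= M)%N then lg p / p%:R else 0).
  rewrite !mulr_sumr -big_split /=; apply: eq_bigr => p pP.
  have [pp _ _ _] := sieve_primesP pP.
  have p0 : (p%:R : R) != 0 by rewrite pnatr_eq0 -lt0n prime_gt0.
  rewrite /prime_cost; case: ifP => _; field; rewrite p0 gt_eqF //.
have step1 : 2 / s * \sum_(p in P) lg p / p%:R * (s - lg p) <=
    2 / s * ((s ^+ 2 + 1) / 2) by rewrite ler_wpM2l // divr_ge0 // ltW.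
have e1 : 2 / s * ((s ^+ 2 + 1) / 2) = s + s^-1.
  by field; rewrite gt_eqF.
have sV : s^-1 <= 1 / 440.
  by rewrite div1r lef_pV2 ?posrE.
rewrite e1 in step1; move: step1 sum2 sV.
set x := 2 / s * _; set z := \sum_(p in P) (if _ then _ else _).
move: x z (s^-1) => x z v; lra.
Qed.

Definition has_large_square (t : nat) : bool :=
  [exists p : 'I_(m ^ (66 * k)).+1, [&& prime p, (M < p)%N &
    (p ^ 2 %| lin W t)%N || (p ^ 2 %| lin (2 * W) t)%N]].

Lemma large_prime_coprime p j : prime p -> (M < p)%N ->
  coprime (p ^ j) (2 * W) /\ coprime (p ^ j) W.
Proof.
move=> pp Mp.
have cop : coprime (p ^ j) (2 * W).
  rewrite coprimeXl // prime_coprime // gtnNdvd ?muln_gt0 ?W_gt0 //.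
  exact: leq_ltn_trans W_le Mp.
by split=> //; move: cop; rewrite coprimeMr => /andP[].
Qed.

Lemma count_large_square_le :
  \sum_(t < N) ((has_large_square t)%:R : R) <= 4 * N%:R / M%:R.
Proof.
pose n := (m ^ (66 * k))%N.
have W2_gt0 : (0 < 2 * W)%N by rewrite muln_gt0.
apply: (@le_trans _ _ (\sum_(t < N) \sum_(p < n.+1 | prime p && (M < p)%N)
   ((p ^ 2 %| lin W t)%N%:R + (p ^ 2 %| lin (2 * W) t)%N%:R : R))).
  apply: ler_sum => t _; rewrite /has_large_square -/n.
  case: existsP => [[p /and3P[pp Mp dp]]|_]; last first.
    by apply: sumr_ge0 => p _; rewrite addr_ge0 ?ler0n.
  rewrite (bigD1 p) ?pp //= -[leLHS]addr0 lerD //.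
    by case/orP: dp => ->; rewrite ?lerDl ?lerDr ler0n.
  by apply: sumr_ge0 => q _; rewrite addr_ge0 ?ler0n.
rewrite exchange_big /=.
apply: (@le_trans _ _ (\sum_(p < n.+1 | prime p && (M < p)%N)
   (2 * N%:R * (p%:R ^+ 2)^-1 + 2))).
  apply: ler_sum => p /andP[pp Mp]; rewrite big_split /=.
  have [c2 c1] := large_prime_coprime 2 pp Mp.
  have p2 : (0 < p ^ 2)%N by rewrite expn_gt0 prime_gt0.
  have := lerD (count_lin_le N W_gt0 p2 c1) (count_lin_le N W2_gt0 p2 c2).
  have -> : (p ^ 2)%:R = p%:R ^+ 2 :> R by rewrite natrX.
  move=> /le_trans; apply; rewrite le_eqVlt; apply/orP; left; apply/eqP.
  by move: (N%:R) (p%:R ^+ 2)^-1 => x z; ring.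
apply: (@le_trans _ _ (\sum_(M.+1 <= p < n.+1)
   (2 * N%:R * (p%:R ^+ 2)^-1 + 2 : R))).
  rewrite big_geq_mkord /= [leRHS](bigID (fun p : 'I_n.+1 => prime p)) /=.
  rewrite [X in X + _](eq_bigl (fun p : 'I_n.+1 => prime p && (M < p)%N)).
    rewrite lerDl sumr_ge0 // => p _.
    by rewrite addr_ge0 // mulr_ge0 ?invr_ge0 ?sqr_ge0 ?mulr_ge0 ?ler0n.
  by move=> p; rewrite andbC.
rewrite big_split /= -mulr_sumr.
have M0 : (0 < M)%N by rewrite expn_gt0 m_gt0.
have M0R : 0 < M%:R :> R by rewrite ltr0n.
have -> : 4 * N%:R / M%:R = 2 * N%:R * M%:R^-1 + 2 * (N%:R * M%:R^-1) :> R.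
  by move: (N%:R : R) (M%:R^-1 : R) => x z; ring.
apply: lerD.
  by rewrite ler_wpM2l ?mulr_ge0 ?ler0n // sum_inv_sqr_le.
rewrite sumr_const_nat -[leLHS]mulr_natr ler_wpM2l ?ler0n // ler_pdivlMr // -natrM ler_nat.
rewrite subSS; apply: (@leq_trans (n * M)); first by rewrite leq_mul2r leq_subr orbT.
by rewrite /n -expnD; apply: (leq_pexp2l m_gt0); lia.
Qed.

Lemma lin_bounds t : (t < N)%N ->
  [/\ (1 < lin W t)%N, (lin W t <= m ^ (131 * k))%N &
      (lin (2 * W) t <= m ^ (131 * k))%N].
Proof.
move=> tN; have le2 : (2 * W * t.+1 <= m ^ (131 * k))%N.
  have -> : (131 * k = k + 130 * k)%N by lia.
  by rewrite expnD leq_mul.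
by split; rewrite /lin; nia.
Qed.

Lemma twin_bounds t : (t < N)%N ->
  (0 < twin W t)%N /\ lg (twin W t) <= (262 * k)%:R * lg m.
Proof.
move=> tN; have [l1 l2 l3] := lin_bounds tN.
have l4 : (0 < lin (2 * W) t)%N by rewrite lin_double // addn1.
have l5 : (0 < lin W t)%N by exact: ltnW.
rewrite /twin muln_gt0 l4 l5; split=> //.
rewrite lgM //.
have h1 : lg (lin W t) <= (131 * k)%:R * lg m by rewrite -lgX // lg_le.
have h2 : lg (lin (2 * W) t) <= (131 * k)%:R * lg m by rewrite -lgX // lg_le.
have -> : (262 * k)%:R = (131 * k)%:R + (131 * k)%:R :> R.
  by rewrite -natrD; congr (_%:R); lia.
by rewrite mulrDl lerD.
Qed.

Lemma sum_weight_large_square_le :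
  \sum_(t < N) (has_large_square t)%:R * selberg_weight t ^+ 2 <=
  4 * (N%:R * (s ^+ 2 / m%:R ^+ 2)).
Proof.
have m0 : 0 < m%:R :> R by rewrite ltr0n.
have s0 : 0 <= s by exact: lg_ge0.
apply: (@le_trans _ _ (4 * N%:R / M%:R * (s ^+ 2 * m%:R ^+ 20))).
  apply: (@le_trans _ _ (\sum_(t < N) (has_large_square t)%:R *
    (s ^+ 2 * m%:R ^+ 20))); last first.
    rewrite -mulr_suml ler_wpM2r ?count_large_square_le //.
    by rewrite mulr_ge0 ?sqr_ge0 ?exprn_ge0 ?ler0n.
  apply: ler_sum => t _; rewrite ler_wpM2l ?ler0n //.
  have [t0 le_t] := twin_bounds (ltn_ord t).
  have le_w : `|selberg_weight t| <= s * m%:R ^+ 10.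
    apply: le_trans (selberg_weight_le k_gt0 le_t t0) _.
    rewrite -mulrA ler_wpM2l // -[10%N]/(8 + 2)%N exprD natrX.
    by rewrite ler_wpM2l ?exprn_ge0 ?ler0n // -natrX lg_D_le.
  rewrite -(real_normK (num_real _)) -[20%N]/(10 * 2)%N exprM -exprMn.
  by rewrite ler_pXn2r // nnegrE ?mulr_ge0 ?exprn_ge0 ?ler0n.
have -> : 4 * N%:R / M%:R * (s ^+ 2 * m%:R ^+ 20) =
    4 * (N%:R * (s ^+ 2 * (m%:R ^+ 20 / M%:R))).
  by move: (N%:R : R) (M%:R^-1 : R) (s ^+ 2) (m%:R ^+ 20 : R) => *; ring.
do 3!(rewrite ler_wpM2l ?ler0n ?sqr_ge0 //).
rewrite natrX ler_pdivrMr ?exprn_gt0 // ler_pdivlMl ?exprn_gt0 // -exprD.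
by rewrite ler_weXn2l // ler1n.
Qed.

Lemma sieve_arithmetic (a b c d e f g i : R) :
  B * a <= b + B * c -> d - 2 * e <= a ->
  b <= 2975 / 1000 * d + 40 * f -> c <= 4 * i -> f <= i -> i <= d / 1000 ->
  g <= f -> e <= g -> 0 < d -> False.
Proof. by move=> *; lra. Qed.

Lemma D3m4_le : (D ^ 3 * m ^ 4 <= N)%N.
Proof. by rewrite DE -expnM -expnD; apply: (leq_pexp2l m_gt0); lia. Qed.

Lemma exists_good_t : exists2 t : nat, (t < N)%N &
  \sum_(p in P) (p %| twin W t)%N%:R * prime_cost p +
    B * (has_large_square t)%:R < B.
Proof.
have s440 := lg_D_ge; have s0 : 0 < s by apply: lt_le_trans s440.
have m0 : 0 < m%:R :> R by rewrite ltr0n.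
have N0 : 0 <= N%:R :> R by rewrite ler0n.
pose cost t := \sum_(p in P) (p %| twin W t)%N%:R * prime_cost p +
    B * (has_large_square t)%:R.
have [[t Ht]|no] := classic (exists t : 'I_N, cost t < B).
  by exists t.
have cost_ge (t : 'I_N) : B <= cost t.
  by rewrite leNgt; apply/negP => lt_c; apply: no; exists t.
exfalso.
have h0 : B * \sum_(t < N) selberg_weight t ^+ 2 <=
    \sum_(t < N) cost t * selberg_weight t ^+ 2.
  by rewrite mulr_sumr; apply: ler_sum => t _; rewrite ler_wpM2r ?sqr_ge0.
have split_cost : \sum_(t < N) cost t * selberg_weight t ^+ 2 =
   \sum_(p in P) prime_cost p *
     (\sum_(t < N) (p %| twin W t)%N%:R * selberg_weight t ^+ 2) +
   B * \sum_(t < N) (has_large_square t)%:R * selberg_weight t ^+ 2.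
  rewrite mulr_sumr; under [X in _ = X + _]eq_bigr do rewrite mulr_sumr.
  rewrite exchange_big /= -big_split /=; apply: eq_bigr => t _.
  rewrite /cost mulrDl mulr_suml; congr (_ + _); last by rewrite mulrA.
  by apply: eq_bigr => p _; ring.
pose E := s ^+ 2 * (m%:R ^+ 2 * D%:R ^+ 2).
have E0 : 0 <= E by rewrite /E -!exprMn sqr_ge0.
have errE : selberg_err ^+ 2 <= E.
  have err0 : 0 <= selberg_err.
    apply: sumr_ge0 => A sA; rewrite mulr_ge0 ?mulr_ge0 ?prod_h_ge0 //.
    by apply: prodr_ge0 => p _; rewrite ler0n.
  rewrite /E -!exprMn -natrM ler_pXn2r ?nnegrE ?mulr_ge0 ?ler0n ?(ltW s0) //.
  exact: selberg_err_le.
have sN : D%:R * E <= N%:R * (s ^+ 2 / m%:R ^+ 2).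
  rewrite /E mulrCA [leRHS]mulrCA ler_wpM2l ?sqr_ge0 //.
  rewrite ler_pdivlMr ?exprn_gt0 //.
  have -> : D%:R * (m%:R ^+ 2 * D%:R ^+ 2) * m%:R ^+ 2 = D%:R ^+ 3 * m%:R ^+ 4 :> R.
    by move: (D%:R : R) (m%:R : R) => x z; ring.
  by rewrite -(natrX R D 3) -(natrX R m 4) -natrM ler_nat D3m4_le.
have E_le : E <= D%:R * E by rewrite ler_peMl // ler1n.
clearbody E.
have h1 := sum_weight_sqr_ge N.
have G0 : 0 <= selberg_G.
  by apply: sumr_ge0 => A sA; rewrite mulr_ge0 ?prod_h_ge0 ?selberg_y_ge0.
have h2 : \sum_(p in P) prime_cost p *
     (\sum_(t < N) (p %| twin W t)%N%:R * selberg_weight t ^+ 2) <=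
   N%:R * (2975 / 1000 * selberg_J) + 40 * (D%:R * E).
  apply: (@le_trans _ _ (\sum_(p in P)
     (N%:R * selberg_G * (prime_cost p * (2 / p%:R * lg p)) + 20 * E))).
    apply: ler_sum => p pP; have [c0 c1 c5] := prime_cost_bounds pP.
    apply: le_trans (ler_wpM2l c1 (sum_weight_sqr_root_le N pP)) _.
    have : prime_cost p * (4 * selberg_err ^+ 2) <= 5 * (4 * E).
      by apply: ler_pM => //; rewrite ?ler_wpM2l // mulr_ge0 ?sqr_ge0.
    rewrite mulrDr; move: (prime_cost p * (4 * _)) => x; move=> xE.
    have -> : 20 * E = 5 * (4 * E) by ring.
    rewrite lerD //.
    by rewrite le_eqVlt; apply/orP; left; apply/eqP; ring.
  rewrite big_split /= -mulr_sumr sumr_const -[X in _ + X <= _]mulr_natl.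
  have cardP : (#|P|%:R : R) <= 2 * D%:R.
    rewrite -natrM ler_nat; apply: leq_trans (max_card _) _.
    by rewrite card_ord mul2n -addnn -addn1 leq_add2l.
  apply: lerD; last first.
    have -> : 40 * (D%:R * E) = 2 * D%:R * (20 * E) by ring.
    by rewrite ler_wpM2r // mulr_ge0.
  rewrite -mulrA ler_wpM2l //.
  apply: (@le_trans _ _ (selberg_G * (1346 / 1000 * s))).
    by rewrite ler_wpM2l // sum_prime_cost_le.
  have J0 : 0 <= selberg_J by apply: le_trans selberg_J_ge; exact: sqr_ge0.
  rewrite mulrCA (mulrC selberg_G); have := selberg_G_le; move: J0.
  by move: (s * selberg_G) selberg_J => u v; lra.
have h3 := sum_weight_large_square_le.
have J1 := selberg_J_ge.
have m1000 : 1000 <= m%:R :> R by rewrite ler_nat.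
have small : s ^+ 2 / m%:R ^+ 2 <= selberg_J / 1000.
  rewrite ler_pdivrMr ?exprn_gt0 //; apply: (le_trans J1).
  have : 1000 <= m%:R ^+ 2 :> R by rewrite expr2; nra.
  have : 0 <= selberg_J by apply: le_trans (J1); exact: sqr_ge0.
  move=> J0 m2; rewrite [leRHS]mulrAC ler_pdivlMr ?ltr0n // ler_wpM2l //.
have J0 : 0 < selberg_J by apply: lt_le_trans (J1); rewrite exprn_gt0.
have N1 : 0 < N%:R :> R by rewrite ltr0n expn_gt0 m_gt0.
have NJ : 0 < N%:R * selberg_J by exact: mulr_gt0.
have NS : N%:R * (s ^+ 2 / m%:R ^+ 2) <= N%:R * selberg_J / 1000.
  by rewrite -mulrA ler_wpM2l.
rewrite split_cost in h0; move: h0 h1 h2 h3 sN NS E_le errE NJ.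
rewrite [N%:R * (2975 / 1000 * _)]mulrCA.
exact: sieve_arithmetic.
Qed.

Lemma exists_twin_almost_prime : exists2 n : nat, (M < n)%N &
  exists l : seq nat, [/\ all prime l, (size l <= 9)%N
    & (\prod_(q <- l) q = n * (2 * n + 1))%N].
Proof.
have [t tN cost_lt] := exists_good_t.
have s440 := lg_D_ge; have s0 : 0 < s by apply: lt_le_trans s440.
have [n_gt1 n_le n'_le] := lin_bounds tN.
set n := lin W t in n_gt1 n_le *; pose n' := lin (2 * W) t.
have n'E : n' = (2 * n + 1)%N by exact: lin_double.
have n0 : (0 < n)%N by exact: ltnW.
have n'0 : (0 < n')%N by rewrite n'E addn1.
have term_ge0 (p : 'I_D.+1) : p \in P -> 0 <= (p %| twin W t)%N%:R * prime_cost p.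
  by move=> pP; have [_ c0 _] := prime_cost_bounds pP; rewrite mulr_ge0 ?ler0n.
have sum_ge0 : 0 <= \sum_(p in P) (p %| twin W t)%N%:R * prime_cost p.
  exact: sumr_ge0.
have no_square : ~~ has_large_square t.
  by apply/negP => bad; move: cost_lt; rewrite bad mulr1 ltNge lerDr sum_ge0.
have cost_lt' : \sum_(p in P) (p %| twin W t)%N%:R * prime_cost p < B.
  by move: cost_lt; rewrite (negPf no_square) mulr0 addr0.
have M_lt q : prime q -> (q %| twin W t)%N -> (M < q)%N.
  move=> pq qd; rewrite ltnNge; apply/negP => qM.
  have [qw | wq] := leqP q w.
    have qW := W_dvd pq qw.
    have nd a : (0 < a)%N -> (q %| a)%N -> ~~ (q %| lin a t)%N.
      move=> a0 qa; apply/negP => ql.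
      have : (q %| (lin a t).+1)%N by rewrite /lin prednK ?muln_gt0 ?a0 ?dvdn_mulr.
      rewrite -addn1 dvdn_addr // dvdn1 => /eqP q1.
      by rewrite q1 in pq.
    move: qd; rewrite /twin Euclid_dvdM // => /orP[].
      by apply/negP/nd.
    by apply/negP/nd; rewrite ?muln_gt0 ?dvdn_mull.
  have qD : (q < D.+1)%N.
    rewrite ltnS DE; apply: leq_trans qM _; rewrite leq_pexp2l //.
    by rewrite leq_pmull.
  have qP : Ordinal qD \in P by rewrite inE pq wq.
  move: cost_lt'; rewrite (bigD1 (Ordinal qD)) //= qd mul1r.
  have [c0 _ _] := prime_cost_bounds qP; move: c0; rewrite /prime_cost /= qM => c0.
  have : 0 <= \sum_(i in P | i != Ordinal qD) (i %| twin W t)%N%:R * prime_cost i.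
    by apply: sumr_ge0 => i /andP[iP _]; exact: term_ge0.
  rewrite /prime_cost; move: (\sum_(i in P | _) _) (1 - _) c0 => x z; lra.
have sqf a : (0 < a)%N -> (a <= m ^ (131 * k))%N -> (a = n \/ a = n') ->
    forall p, prime p -> ~~ (p ^ 2 %| a)%N.
  move=> a0 a_le an p pp; apply/negP => pa; move/negP: no_square; apply.
  have p_le : (p < (m ^ (66 * k)).+1)%N.
    rewrite ltnS -(@leq_exp2r _ _ 2) //; apply: leq_trans (dvdn_leq a0 pa) _.
    apply: leq_trans a_le _; rewrite -expnM; apply: (leq_pexp2l m_gt0).
    by rewrite -mulnA (mulnC k) mulnA leq_mul2r orbT.
  have pt : (p %| twin W t)%N.
    have pa' : (p %| a)%N by apply: dvdn_trans pa; rewrite dvdn_exp.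
    by case: an pa' => -> d; rewrite /twin -/n -/n' ?(dvdn_mulr _ d) ?(dvdn_mull _ d).
  apply/existsP; exists (Ordinal p_le); rewrite /= pp M_lt //=.
  by case: an pa => -> ->; rewrite ?orbT.
pose l := primes n ++ primes n'.
have memP q : q \in l -> prime q /\ (q %| twin W t)%N.
  rewrite mem_cat !mem_primes => /orP[] /and3P[pq _ qd]; split=> //.
    by rewrite /twin dvdn_mulr.
  by rewrite /twin dvdn_mull.
have prodE : (\prod_(q <- l) q = n * n')%N.
  rewrite big_cat /= !squarefree_prod_primes //; first by apply: sqf; auto.
  by apply: sqf; auto.
have uniq_l : uniq l.
  rewrite cat_uniq !primes_uniq andbT /=; apply/hasPn => q.
  rewrite !mem_primes => /and3P[pq _ qn']; apply/negP => /and3P[_ _ qn].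
  move: qn'; rewrite n'E dvdn_addr ?dvdn_mull // dvdn1 => /eqP q1.
  by rewrite q1 in pq.
exists n.
  have := pdiv_prime n_gt1 => /M_lt; rewrite /twin dvdn_mulr ?pdiv_dvd // => /(_ isT).
  by move=> /leq_trans; apply; apply: pdiv_leq.
exists l; split.
- by apply/allP => q /memP[].
- have sum_lg : \sum_(q <- l) lg q <= (262 * k)%:R * lg m.
    have [_ le_t] := twin_bounds tN; apply: le_trans le_t.
    rewrite big_seq -lg_prod; last by move=> q /memP[/prime_gt0].
    by rewrite -big_seq prodE.
  have main : \sum_(q <- l) (1 - lg q / s) < B.
    apply: le_lt_trans cost_lt'.
    rewrite (bigID (fun q => (q <= D)%N)) /=.
    rewrite -[leRHS]addr0 lerD //; last first.
      apply: sumr_le0 => q; rewrite -ltnNge => Dq.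
      by rewrite subr_le0 ler_pdivlMr // mul1r lg_le // ltnW.
    rewrite -big_filter.
    have -> : \sum_(q <- [seq q <- l | (q <= D)%N]) (1 - lg q / s) =
        \sum_(q < D.+1 | (q : nat) \in l) (1 - lg q / s).
      rewrite -(big_mkord (fun q => q \in l) (fun q => 1 - lg q / s)) -[RHS]big_filter.
      apply: perm_big; apply: uniq_perm.
      - by rewrite filter_uniq.
      - by rewrite filter_uniq ?iota_uniq.
      move=> q; rewrite !mem_filter mem_index_iota ltnS /= andbC.
      by case: (q \in l).
    have inP (q : 'I_D.+1) : (q : nat) \in l -> q \in P.
      move=> /memP[pq qd]; rewrite inE pq /=; rewrite ltnNge; apply/negP => qw.
      have := M_lt q pq qd; rewrite ltnNge => /negP; apply.
      apply: leq_trans W_le; apply: leq_trans (dvdn_leq W_gt0 (W_dvd pq qw)) _.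
      exact: leq_pmull.
    rewrite [leRHS](bigID (fun q : 'I_D.+1 => (q : nat) \in l)) /=.
    rewrite -[leLHS]addr0 lerD //; last first.
      by apply: sumr_ge0 => q /andP[qP _]; exact: term_ge0.
    rewrite [leRHS](eq_bigl (fun q : 'I_D.+1 => (q : nat) \in l)); last first.
      by move=> q /=; case: (boolP ((q : nat) \in l)) => [/inP ->|]; rewrite ?andbF.
    apply: ler_sum => q ql; have [pq qd] := memP q ql.
    by rewrite qd mul1r /prime_cost lerDl; case: ifP => _; lra.
  have sizeE : (size l)%:R = \sum_(q <- l) (1 - lg q / s) + (\sum_(q <- l) lg q) / s.
    rewrite mulr_suml -big_split /= (eq_bigr (fun=> 1)); last by move=> q _; rewrite subrK.
    by rewrite big_const_seq count_predT iter_addr_0.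
  have last_le : (\sum_(q <- l) lg q) / s <= 262 / 40.
    rewrite ler_pdivrMr // lgD; apply: le_trans sum_lg _.
    by rewrite !natrM; move: (lg m) (k%:R : R) => x z; lra.
  rewrite -ltnS -(ltr_nat R) sizeE; move: main last_le.
  by move: (\sum_(q <- l) _) (_ / s) => x z; lra.
by rewrite prodE n'E.
Qed.

End SizeBounds.

End SelbergWeights.

Lemma prime_dvd_fact p n : prime p -> (p %| n`!)%N = (p <= n)%N.
Proof.
move=> pp; elim: n => [|n IHn].
  by rewrite fact0 dvdn1 leqn0; case: p pp => [|[|]].
rewrite factS Euclid_dvdM // IHn [RHS]leq_eqVlt ltnS.
have [le_pn | lt_np] := leqP p n; first by rewrite !orbT.
rewrite !orbF; apply/idP/eqP => [/dvdn_leq le_p | ->]; last exact: dvdnn.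
by apply/eqP; rewrite eqn_leq lt_np le_p.
Qed.

Lemma twin_almost_primes b : exists2 n : nat, (b < n)%N &
  exists l : seq nat, [/\ all prime l, (size l <= 9)%N
    & (\prod_(q <- l) q = n * (2 * n + 1))%N].
Proof.
have lg5 : 0 < lg 5 by exact: lg_gt0.
have [w [w_gt1 lgw]] := lg_unbounded (880 * lg 5 + 22).
have w_ge : (22 <= w)%N.
  rewrite -(ler_nat R); have := lg_le_self (ltnW w_gt1); lra.
have lgw2 : 10 <= lg w ^+ 2 by rewrite expr2; nra.
have W_gt0 := fact_gt0 w.
have W_ge : (w <= w`!)%N by rewrite dvdn_leq // dvdn_fact // leqnn ltnW.
have [k kE] : exists k, k = 22%N by exists 22%N.
pose m := (1000 + 2 * w`! + b)%N.
have m_gt0 : (0 < m)%N by rewrite /m; lia.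
have k_gt0 : (0 < k)%N by rewrite kE.
have D_gt0 : (0 < m ^ (40 * k))%N by rewrite expn_gt0 m_gt0.
have le_mM : (m <= m ^ k)%N by rewrite -{1}(expn1 m) leq_pexp2l.
have cop p : prime p -> (w < p)%N -> coprime p (2 * w`!).
  move=> pp wp; rewrite prime_coprime // Euclid_dvdM // negb_or.
  by rewrite prime_dvd_fact // -ltnNge wp gtnNdvd //; lia.
have kR : (40 * k)%:R = 880 :> R by rewrite kE.
have lgw5 : (40 * k)%:R * lg 5 <= lg w by rewrite kR; lra.
have [n Mn Hn] := exists_twin_almost_prime (k := k) W_gt0 D_gt0 w_ge lgw2 cop
  m_gt0 (lgX _ m_gt0) lgw5 ltac:(by rewrite kE) erefl ltac:(by rewrite /m; lia)
  ltac:(by rewrite kE /m; lia) ltac:(by apply: leq_trans le_mM; rewrite /m; lia)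
  ltac:(by apply: leq_trans W_ge; lia)
  (fun p pp pw => etrans (prime_dvd_fact w pp) pw).
by exists n => //; apply: leq_trans Mn; rewrite ltnS; apply: leq_trans le_mM; rewrite /m; lia.
Qed.

(** * Zariski density *)

Lemma poly_nat_roots_eq0 (Q : {poly algC}) :
  (forall k, exists2 n : nat, (k < n)%N & Q.[n%:R] = 0) -> Q = 0.
Proof.
move=> HQ; apply/eqP; apply: contraT => Q0.
have [s [us rs szs]] : exists s : seq nat,
    [/\ uniq s, all (fun n => root Q n%:R) s & size s = size Q].
  elim: (size Q) => [|k [s [us rs szs]]]; first by exists [::].
  have [n ltn Qn] := HQ (\max_(i <- s) i)%N.
  exists (n :: s); rewrite /= us rs szs andbT rootE Qn eqxx; split => //.
  apply/negP => ns; move: ltn; rewrite ltnNge.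
  by rewrite (big_rem n ns) /= leq_maxl.
have := max_poly_roots (rs := [seq n%:R | n <- s]) Q0.
rewrite all_map rs size_map szs ltnn => /(_ isT); apply.
by rewrite map_inj_uniq // => i j /eqP; rewrite eqr_nat => /eqP.
Qed.

Lemma meval_row_scale n d (f : {mpoly rat[n]}) (x : 'rV[algC]_n) (u : algC) :
  f \is d.-homog ->
  (map_mpoly ratr f).@[(u *: x) 0] = u ^+ d * (map_mpoly ratr f).@[x 0].
Proof.
move=> /dhomogP fd; rewrite !mevalE mulr_sumr !big_seq; apply: eq_bigr => m.
rewrite (perm_mem (msupp_map_mpoly _ (fmorph_inj _))) // => mf.
have -> : d = (\sum_i m i)%N by rewrite -mdegE; apply/esym/fd.
rewrite mulrCA; congr (_ * _).
rewrite -prodrXr -big_split /=; apply: eq_bigr => i _.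
by rewrite mxE exprMn.
Qed.

Lemma meval_torsor_poly (f : {mpoly rat[7]})
    (E1 E2 E3 E4 A1 A2 A3 : {poly algC}) :
  exists Q : {poly algC}, forall u, Q.[u] = (map_mpoly ratr f).@[
    torsor_map E1.[u] E2.[u] E3.[u] E4.[u] A1.[u] A2.[u] A3.[u] 0].
Proof.
pose T a b c d := E1 ^+ a * E2 ^+ b * E3 ^+ c * E4 ^+ d.
pose g (i : 'I_7) := [:: A2 * A3; T 1 1 1 0 * A1 * A2; T 1 1 0 1 * A1 * A3;
  T 2 1 2 1 * A2; T 2 1 1 2 * A3; T 4 2 3 3; T 3 2 2 2 * A1]`_i.
pose F := map_mpoly (ratr : rat -> algC) f.
exists (\sum_(m <- msupp F) (F@_m)%:P * \prod_i g i ^+ m i) => u.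
rewrite mevalE horner_sum; apply: eq_bigr => m _.
rewrite hornerM hornerC horner_prod; congr (_ * _); apply: eq_bigr => i _.
rewrite horner_exp mxE; congr (_ ^+ _).
by case: i => -[|[|[|[|[|[|[|//]]]]]]] lti; rewrite /= /T /etapow
  ?(hornerM, horner_exp).
Qed.

Lemma torsor_curve_vanish (f : {mpoly rat[7]})
    (E1 E2 E3 E4 A1 A2 A3 : {poly algC}) :
    (forall k, exists2 n : nat, (k < n)%N & vanishes_at f
       (torsor_map E1.[n%:R] E2.[n%:R] E3.[n%:R] E4.[n%:R]
          A1.[n%:R] A2.[n%:R] A3.[n%:R])) ->
  forall u, vanishes_at f
    (torsor_map E1.[u] E2.[u] E3.[u] E4.[u] A1.[u] A2.[u] A3.[u]).
Proof.
move=> Hf u; have [Q QE] := meval_torsor_poly f E1 E2 E3 E4 A1 A2 A3.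
rewrite /vanishes_at -QE (_ : Q = 0) ?horner0 //.
apply: poly_nat_roots_eq0 => k; have [n kn fn] := Hf k.
by exists n => //; rewrite QE.
Qed.

Lemma torsor_curve_generic (f : {mpoly rat[7]})
    (D E1 E2 E3 E4 A1 A2 A3 : {poly algC}) : D != 0 ->
    (forall u, D.[u] != 0 -> vanishes_at f
       (torsor_map E1.[u] E2.[u] E3.[u] E4.[u] A1.[u] A2.[u] A3.[u])) ->
  forall u, vanishes_at f
    (torsor_map E1.[u] E2.[u] E3.[u] E4.[u] A1.[u] A2.[u] A3.[u]).
Proof.
move=> D0 Hf u; have [Q QE] := meval_torsor_poly f E1 E2 E3 E4 A1 A2 A3.
rewrite /vanishes_at -QE (_ : Q = 0) ?horner0 //.
suff : D * Q = 0 by move=> /eqP; rewrite mulf_eq0 (negPf D0) => /eqP.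
apply: poly_nat_roots_eq0 => k; exists k.+1 => //; rewrite hornerM.
have [-> | Dk] := eqVneq D.[k.+1%:R] 0; first by rewrite mul0r.
by rewrite QE Hf ?mulr0.
Qed.

(* [e1 e3 e4 / a1] and [b] are invariant under the Picard torus, which scales
   any torsor point with nonzero [e2], [e3], [e4], [a1] to this normal form. *)
Lemma torsor_map_rescale (e1 e2 e3 e4 a1 a2 a3 : algC) :
    e2 != 0 -> e3 != 0 -> e4 != 0 -> a1 != 0 ->
    e2 * a1 ^+ 2 + e3 * a2 + e4 * a3 = 0 ->
  let b := e3 * a2 / (e2 * a1 ^+ 2) in
  torsor_map e1 e2 e3 e4 a1 a2 a3 = (e2 ^+ 2 * a1 ^+ 4 / (e3 * e4)) *:
    torsor_map (e1 * e3 * e4 / a1) 1 1 1 1 b (- 1 - b).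
Proof.
move=> n2 n3 n4 n1 eq0 b.
have -> : -1 - b = e4 * a3 / (e2 * a1 ^+ 2).
  have -> : e4 * a3 = - (e2 * a1 ^+ 2) - e3 * a2.
    by apply/eqP; rewrite -subr_eq0 -eq0; apply/eqP; ring.
  by rewrite /b; field; apply/andP.
apply/rowP => -[[|[|[|[|[|[|[|//]]]]]]] lti]; rewrite !mxE /= /etapow /b;
  rewrite ?expr1n ?expr0 ?expr1; field; rewrite ?n1 ?n2 ?n3 ?n4 //.
Qed.

Lemma vanish_torsor_image d (f : {mpoly rat[7]}) : f \is d.-homog ->
    (forall u b, vanishes_at f (torsor_map u 1 1 1 1 b (- 1 - b))) ->
  forall e1 e2 e3 e4 a1 a2 a3 : algC,
    e2 * a1 ^+ 2 + e3 * a2 + e4 * a3 = 0 ->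
  vanishes_at f (torsor_map e1 e2 e3 e4 a1 a2 a3).
Proof.
move=> fd Hf.
have gen e1 e2 e3 e4 a1 a2 a3 : e2 != 0 -> e3 != 0 -> e4 != 0 -> a1 != 0 ->
    e2 * a1 ^+ 2 + e3 * a2 + e4 * a3 = 0 ->
    vanishes_at f (torsor_map e1 e2 e3 e4 a1 a2 a3).
  move=> n2 n3 n4 n1 eq0; rewrite /vanishes_at torsor_map_rescale //.
  by rewrite (meval_row_scale _ _ fd) Hf mulr0.
have XD0 (c : algC) : 'X + c%:P != 0.
  by rewrite -[c]opprK polyCN polyXsubC_eq0.
have XDE (c u : algC) : ('X + c%:P).[u] = u + c.
  by rewrite hornerD hornerX hornerC.
move=> e1 e2 e3 e4 a1 a2 a3 eq0.
have [z3|n3] := eqVneq e3 0; last first.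
  pose A2 := - (e3^-1)%:P * (('X + e2%:P) * ('X + a1%:P) ^+ 2 +
     ('X + e4%:P) * a3%:P).
  have A2E u : A2.[u] =
      - e3^-1 * ((u + e2) * (u + a1) ^+ 2 + (u + e4) * a3).
    by rewrite /A2 !(hornerM, hornerD, hornerN, hornerC, hornerX, horner_exp).
  pose D := ('X + e2%:P) * ('X + a1%:P) * ('X + e4%:P).
  have D0 : D != 0 by rewrite !mulf_neq0.
  have := @torsor_curve_generic f D e1%:P ('X + e2%:P) e3%:P ('X + e4%:P)
    ('X + a1%:P) A2 a3%:P D0.
  have -> : torsor_map e1 e2 e3 e4 a1 a2 a3 = torsor_map (e1%:P).[0]
    ('X + e2%:P).[0] (e3%:P).[0] ('X + e4%:P).[0] ('X + a1%:P).[0] A2.[0]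
    (a3%:P).[0].
    rewrite A2E !XDE !hornerC !add0r; congr torsor_map.
    have eE : e3 * a2 = - (e2 * a1 ^+ 2 + e4 * a3).
      by apply/eqP; rewrite -subr_eq0 -eq0; apply/eqP; ring.
    by rewrite -[LHS](mulKf n3) eE; ring.
  apply => u; rewrite /D A2E !hornerM !XDE !hornerC !mulf_eq0 !negb_or.
  case/andP=> /andP[n2 n1] n4; apply: gen => //; by field.
have [z4|n4] := eqVneq e4 0; last first.
  pose A3 := - (e4^-1)%:P * (('X + e2%:P) * ('X + a1%:P) ^+ 2 +
     ('X + e3%:P) * a2%:P).
  have A3E u : A3.[u] =
      - e4^-1 * ((u + e2) * (u + a1) ^+ 2 + (u + e3) * a2).
    by rewrite /A3 !(hornerM, hornerD, hornerN, hornerC, hornerX, horner_exp).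
  pose D := ('X + e2%:P) * ('X + a1%:P) * ('X + e3%:P).
  have D0 : D != 0 by rewrite !mulf_neq0.
  have := @torsor_curve_generic f D e1%:P ('X + e2%:P) ('X + e3%:P) e4%:P
    ('X + a1%:P) a2%:P A3 D0.
  have -> : torsor_map e1 e2 e3 e4 a1 a2 a3 = torsor_map (e1%:P).[0]
    ('X + e2%:P).[0] ('X + e3%:P).[0] (e4%:P).[0] ('X + a1%:P).[0]
    (a2%:P).[0] A3.[0].
    rewrite A3E !XDE !hornerC !add0r; congr torsor_map.
    have eE : e4 * a3 = - (e2 * a1 ^+ 2 + e3 * a2).
      by apply/eqP; rewrite -subr_eq0 -eq0; apply/eqP; ring.
    by rewrite -[LHS](mulKf n4) eE; ring.
  apply => u; rewrite /D A3E !hornerM !XDE !hornerC !mulf_eq0 !negb_or.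
  case/andP=> /andP[n2 n1] n3; apply: gen => //; by field.
have -> : torsor_map e1 e2 e3 e4 a1 a2 a3 =
    (- (a2 * a3) / 2) *: torsor_map 0 1 1 1 1 1 (-1 - 1).
  apply/rowP => -[[|[|[|[|[|[|[|//]]]]]]] lti]; rewrite !mxE /= /etapow;
    rewrite ?z3 ?z4 ?expr0n /= ?(mulr0, mul0r) //.
  by field.
by rewrite /vanishes_at (meval_row_scale _ _ fd) Hf mulr0.
Qed.

Lemma torsor_point_almost_prime (p n : nat) (s : seq nat) :
    prime p -> (n * 2 + 1 < p)%N -> (0 < n)%N ->
    all prime s -> (size s <= 9)%N -> (\prod_(q <- s) q = n * (2 * n + 1))%N ->
  almost_prime_points X0 (@coord_prod 7) 45
    (torsor_map p%:R 1 1 1 1 (2 * n)%:R (- 1 - (2 * n)%:R)).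
Proof.
move=> pp ltp n0 sp szs sE.
pose b := (2 * n)%:Z; pose c : int := - 1 - b; pose P := p%:Z.
pose x : 'rV[int]_7 := \row_(i < 7)
  [:: b * c; P * b; P * c; P ^+ 2 * b; P ^+ 2 * c; P ^+ 4; P ^+ 3]`_i.
have cE : `|c|%N = (2 * n + 1)%N by rewrite /c /b; lia.
have xE : torsor_map p%:R 1 1 1 1 (2 * n)%:R (- 1 - (2 * n)%:R) = map_mx intr x.
  apply/rowP => -[[|[|[|[|[|[|[|//]]]]]]] lti]; rewrite !mxE /= /etapow;
    rewrite ?expr1n ?expr0 ?expr1 ?mulr1 ?mul1r;
    rewrite ?(rmorphM, rmorphXn, rmorphB, rmorphN, rmorph1) /= ?pmulrn //=.
exists x; split => //.
- apply/eqP; rewrite -dvdn1.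
  have cop : coprime (2 * n * (2 * n + 1)) (p ^ 4).
    rewrite coprime_sym coprimeXl // prime_coprime // Euclid_dvdM // negb_or.
    by rewrite !gtnNdvd //; lia.
  rewrite -[X in (_ %| X)%N](eqP cop) dvdn_gcd.
  apply/andP; split.
    apply: dvdn_trans (biggcdn_inf (Ordinal (isT : 0 < 7)%N) _ (dvdnn _)) _ => //.
    by rewrite mxE /= abszM cE.
  apply: dvdn_trans (biggcdn_inf (Ordinal (isT : 5 < 7)%N) _ (dvdnn _)) _ => //.
  have -> : x 0 (Ordinal (isT : 5 < 7)%N) = P ^+ 4 by rewrite mxE.
  by rewrite abszX.
- split.
    apply/eqP => /rowP /(_ (Ordinal (isT : 5 < 7)%N)).
    rewrite !mxE /= /etapow !expr1n !mulr1 => /eqP.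
    by rewrite expf_eq0 /= pnatr_eq0 => /eqP p0; rewrite p0 in pp.
  move=> d f _; apply; exists p%:R, 1, 1, 1, 1, (2 * n)%:R, (- 1 - (2 * n)%:R).
  split => //; first by ring.
  apply/eqP => /rowP /(_ (Ordinal (isT : 5 < 7)%N)).
  rewrite !mxE /= /etapow !expr1n !mulr1 => /eqP.
  by rewrite expf_eq0 /= pnatr_eq0 => /eqP p0; rewrite p0 in pp.
pose s' := (2 :: s)%N.
have s'p : all prime s' by rewrite /= sp.
have s'E : (\prod_(q <- s') q = 2 * n * (2 * n + 1))%N.
  by rewrite big_cons sE mulnA.
have s'sz : (size s' <= 10)%N by [].
exists (nseq 13 p ++ s' ++ s' ++ s'); split.
- by rewrite !all_cat all_nseq pp s'p.
- by rewrite !size_cat size_nseq; lia.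
have -> : coord_prod x = b ^+ 3 * c ^+ 3 * P ^+ 13.
  by rewrite /coord_prod !big_ord_recl big_ord0 !mxE /=; ring.
rewrite abszM abszM !abszX cE !big_cat s'E big_nseq iter_muln_1.
by move: (p ^ 13)%N => q; rewrite /b /=; ring.
Qed.

Lemma almost_prime_points_dense :
    (forall k, exists2 n : nat, (k < n)%N & exists s : seq nat,
      [/\ all prime s, (size s <= 9)%N
        & (\prod_(q <- s) q = n * (2 * n + 1))%N]) ->
  zariski_dense (almost_prime_points X0 (@coord_prod 7) 45) X0.
Proof.
move=> Hn; split; first by move=> y [x [_ _]].
move=> y [y0 Xy]; split => // d f fd Hf; apply: Xy (fd) _.
move=> _ [e1 [e2 [e3 [e4 [a1 [a2 [a3 [eq0 -> _]]]]]]]].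
apply: (vanish_torsor_image fd) => // u b {eq0}.
have := @torsor_curve_vanish f u%:P 1 1 1 1 'X (- 1 - 'X) _ b.
rewrite !hornerE; apply => k.
have [n kn [s [sp szs sE]]] := Hn k; exists (2 * n)%N; first by lia.
have := @torsor_curve_vanish f 'X 1 1 1 1 (2 * n)%:R%:P (- 1 - (2 * n)%:R%:P) _ u.
rewrite !hornerE; apply => l.
have [p ltp pp] := prime_above (n * 2 + 1 + l); exists p; first by lia.
rewrite !hornerE; apply: Hf; apply: (torsor_point_almost_prime pp _ _ sp szs sE); lia.
Qed.

Lemma ex_least_nat (Q : nat -> Prop) n : Q n ->
  exists2 r, Q r /\ (forall s, Q s -> (r <= s)%N) & (r <= n)%N.
Proof.
elim/ltn_ind: n => n IHn Qn.
have [[m [ltm Qm]]|no] := classic (exists m, (m < n)%N /\ Q m).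
  by have [r Hr le_r] := IHn m ltm Qm; exists r => //; lia.
exists n => //; split => // s Qs; rewrite leqNgt; apply/negP => lts.
by apply: no; exists s.
Qed.

Theorem theorem1p2 :
  (exists2 r : nat, is_saturation_number X0 (@coord_prod 7) r & (r <= 45)%N) /\
  zariski_dense (almost_prime_points X0 (@coord_prod 7) 45) X0.
Proof.
have dense := almost_prime_points_dense twin_almost_primes.
by split=> //; exact: (ex_least_nat dense).
Qed.
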